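(* Let $d,r\ge 1$ be integers, let $(X,\Sigma,\mu)$ be a standard Borel probability space, and let $T_i:\mathbb{Z}^r\curvearrowright (X,\Sigma,\mu)$, $i=1,2,\ldots,d$, be commuting probability-preserving $\mathbb{Z}^r$-actions. Let $f_1,f_2,\ldots,f_d\in L^\infty(\mu)$. Then for every F\o lner sequence $(I_N)_{N\ge 1}$ of subsets of $\mathbb{Z}^r$ and every base-point sequence $(a_N)_{N\ge 1}$ in $\mathbb{Z}^r$, the nonconventional ergodic averages \[\frac{1}{|I_N|}\sum_{n\in I_N+a_N}\ \prod_{i=1}^d f_i\circ T_i^n\] converge in $L^2(\mu)$ as $N\to\infty$, and the limit does not depend on the choice of $(a_N)_{N\ge 1}$ or $(I_N)_{N\ge 1}$.
   Context: The actions $T_1,\ldots,T_d$ commute means $T_i^nT_j^m=T_j^mT_i^n$ for all $i\ne j$ and $n,m\in\mathbb{Z}^r$. A F\o lner sequence in $\mathbb{Z}^r$ is a sequence of nonempty finite sets $I_N\subset\mathbb{Z}^r$ with $|(I_N+h)\triangle I_N|/|I_N|\to 0$ as $N\to\infty$ for every $h\in\mathbb{Z}^r$. A base-point sequence is an arbitrary sequence of elements of $\mathbb{Z}^r$. *)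

(* Defs.v *)
From HB Require Import structures.
From mathcomp Require Import all_boot all_order all_algebra finmap.
From mathcomp Require Import all_classical all_reals all_analysis.
From mathcomp Require Import complex.

Set Implicit Arguments.
Unset Strict Implicit.
Unset Printing Implicit Defensive.

Import Order.TTheory GRing.Theory Num.Theory.
Import numFieldNormedType.Exports.

Local Open Scope classical_set_scope.
Local Open Scope ring_scope.

Definition polish (R : realType) (M : metricType R) : Prop :=
  (exists2 D : set M, countable D & dense D) /\
  (forall u : nat -> M,
     (forall e : R, 0 < e ->
        exists N : nat, forall m n : nat, (N <= m)%N -> (N <= n)%N ->
          mdist (u m) (u n) < e) ->
     exists l : M, u @ \oo --> l).

(* The metric is real valued, hence the parameter R. Since phi is onto, the
   last clause says that phi carries the sigma-algebra of X exactly to the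
   Borel sigma-algebra of M. *)
Definition standard_borel (R : realType) (disp : measure_display)
    (X : measurableType disp) : Prop :=
  exists M : metricType R, polish M /\
    exists2 phi : X -> M, bijective phi &
      forall B : set M, measurable (phi @^-1` B) <-> (<<s open >>) B.

Record pp_action (R : realType) (disp : measure_display)
    (X : measurableType disp) (mu : probability X R) (r : nat)
    (T : 'rV[int]_r -> X -> X) : Prop := PPAction {
  pp_action_measurable : forall n, measurable_fun [set: X] (T n) ;
  pp_action0 : forall x, T 0 x = x ;
  pp_actionD : forall m n x, T (m + n) x = T m (T n x) ;
  pp_action_preserving : forall n (A : set X), measurable A ->
    mu (T n @^-1` A) = mu A }.

Definition commuting_actions (X : Type) (d r : nat)
    (T : 'I_d -> 'rV[int]_r -> X -> X) : Prop :=
  forall i j : 'I_d, i != j -> forall n m : 'rV[int]_r,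
    T i n \o T j m = T j m \o T i n.

Definition translate (r : nat) (A : {fset 'rV[int]_r}) (h : 'rV[int]_r)
    : {fset 'rV[int]_r} := [fset (n + h)%R | n in A]%fset.

Definition symdiff (r : nat) (A B : {fset 'rV[int]_r}) : {fset 'rV[int]_r} :=
  ((A `\` B) `|` (B `\` A))%fset.

Definition folner (R : realType) (r : nat) (I : nat -> {fset 'rV[int]_r})
    : Prop :=
  (forall N, I N != fset0) /\
  (forall h : 'rV[int]_r,
     (#|` symdiff (translate (I N) h) (I N)|%:R / #|` I N|%:R : R)
       @[N --> \oo] --> (0 : R)).

(* ComplexField.Normc.normc is the modulus with values in R, whereas `|z| is
   valued in R[i]. *)
Definition LfunC (R : realType) (disp : measure_display)
    (X : measurableType disp) (mu : probability X R) (p : \bar R)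
    (f : X -> R[i]) : Prop :=
  [/\ measurable_fun [set: X] (fun x => complex.Re (f x)),
      measurable_fun [set: X] (fun x => complex.Im (f x)) &
      finite_norm mu p (fun x => ComplexField.Normc.normc (f x))].

Definition cvg_L2C (R : realType) (disp : measure_display)
    (X : measurableType disp) (mu : probability X R)
    (u : nat -> X -> R[i]) (g : X -> R[i]) : Prop :=
  ('N[mu]_2%:E[EFin \o (fun x => ComplexField.Normc.normc (u N x - g x)%R)])%E
    @[N --> \oo] --> 0%E.

Definition nonconventional_average (R : realType) (X : Type) (d r : nat)
    (T : 'I_d -> 'rV[int]_r -> X -> X) (f : 'I_d -> X -> R[i])
    (I : {fset 'rV[int]_r}) (a : 'rV[int]_r) (x : X) : R[i] :=
  (#|` I|%:R)^-1 * \sum_(n <- translate I a) \prod_(i < d) f i (T i n x).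

(* Main.v *)
Require Import Defs.
From HB Require Import structures.
From mathcomp Require Import all_boot all_order all_algebra finmap.
From mathcomp Require Import all_classical all_reals all_analysis.
From mathcomp Require Import measurable_realfun ess_sup_inf.
From mathcomp Require Import complex ring lra.

Set Implicit Arguments.
Unset Strict Implicit.
Unset Printing Implicit Defensive.

Import Order.TTheory GRing.Theory Num.Theory.
Import numFieldNormedType.Exports.

Local Open Scope classical_set_scope.
Local Open Scope ring_scope.

(* All averages live in an abstract "system": an algebra of bounded functions
   with a positive normalized mean and commuting mean-preserving actions of Z^r.
   No countable additivity is needed, so systems are closed under ultrapowers.

   Induction on d shows that the averages are Cauchy in mean square along any
   Folner sequence F. For the step from T_0, ..., T_{d-1} to T_0, ..., T_d pass
   to the ultrapower X x nat, with mean lim_U mean_X, and let W be the space of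
   all u for which the averages with last function u are Cauchy. Choose g in W
   almost minimizing mean (f_d - g)^2, so that v := f_d - g is almost orthogonal
   to W. If the averages A_N(v) were not eventually small, then
   mean A_{s k}(v_k)^2 > eta for some s k tending to infinity along U.
   Invariance rewrites this mean as <v, sigma>, where
     sigma(., k) =
       avg_{m in F (s k)} h_k o T_d^-m . prod_{i<d} f_i o T_i^m T_d^-m
   and h_k = A_{s k}(v_k). But sigma belongs to W: by the Folner property its
   translate by T_d^n depends on n only through T_0, ..., T_{d-1}, so its
   averages are averages over m of d-fold ones, and these converge uniformly
   enough because m can be absorbed as an extra coordinate of the system. Hence
   <v, sigma> is almost 0, a contradiction.

   The limit is independent of the Folner sequence because two of them can be
   interlaced, and translating a Folner sequence gives a Folner sequence. *)

(** * Finite averages *)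

Section avg.
Context {R : realType} {V : choiceType}.
Implicit Types (A : {fset V}) (a b : V -> R) (c : R).

Definition avg A a : R := (#|` A|%:R)^-1 * \sum_(n <- A) a n.

Lemma avgD A a b : avg A (fun n => a n + b n) = avg A a + avg A b.
Proof. by rewrite /avg big_split mulrDr. Qed.

Lemma avgZl A c a : avg A (fun n => c * a n) = c * avg A a.
Proof. by rewrite /avg -mulr_sumr mulrCA. Qed.

Lemma avgB A a b : avg A (fun n => a n - b n) = avg A a - avg A b.
Proof. by rewrite /avg sumrB mulrBr. Qed.

Lemma avg_cst A c : A != fset0 -> avg A (fun=> c) = c.
Proof.
move=> A0; rewrite /avg big_const_seq count_predT.
rewrite iter_addr addr0 -(mulr_natl c) mulrA mulVf ?mul1r//.
by rewrite pnatr_eq0 -lt0n cardfs_gt0.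
Qed.

Lemma eq_avg A a b : (forall n, a n = b n) -> avg A a = avg A b.
Proof. by move=> ab; rewrite /avg; congr (_ * _); apply: eq_bigr. Qed.

Lemma le_avg A a b : (forall n, a n <= b n) -> avg A a <= avg A b.
Proof.
by move=> ab; rewrite ler_wpM2l ?invr_ge0// ler_sum.
Qed.

Lemma avg_ge0 A a : (forall n, 0 <= a n) -> 0 <= avg A a.
Proof. by move=> a0; rewrite mulr_ge0 ?invr_ge0// sumr_ge0. Qed.

Lemma norm_avg_le A a : `|avg A a| <= avg A (fun n => `|a n|).
Proof.
by rewrite normrM ger0_norm ?invr_ge0// ler_wpM2l ?invr_ge0// ler_norm_sum.
Qed.

Lemma norm_avg_le_cst A a c : A != fset0 -> (forall n, `|a n| <= c) ->
  `|avg A a| <= c.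
Proof.
move=> A0 ac; rewrite (le_trans (norm_avg_le _ _))//.
by rewrite -[leRHS](avg_cst c A0) le_avg.
Qed.

(** The variance of [a] over [A] is nonnegative. The empty set is separate because constants average
    to 0 there. *)
Lemma sqr_avg_le A a : (avg A a) ^+ 2 <= avg A (fun n => a n ^+ 2).
Proof.
have [->|A0] := eqVneq A fset0.
  by rewrite /avg cardfs0 invr0 !mul0r expr0n.
set m := avg A a.
have : 0 <= avg A (fun n => (a n - m) ^+ 2) by apply: avg_ge0 => n; exact: sqr_ge0.
have -> : avg A (fun n => (a n - m) ^+ 2) =
    avg A (fun n => a n ^+ 2) - (2 * m) * avg A a + avg A (fun=> m ^+ 2).
  by rewrite -avgZl -avgB -avgD; apply: eq_avg => n; ring.
by rewrite avg_cst// -/m; lra.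
Qed.

Lemma avg_exchange A B (a : V -> V -> R) :
  avg A (fun n => avg B (fun q => a n q)) = avg B (fun q => avg A (fun n => a n q)).
Proof.
rewrite /avg; under eq_bigr do rewrite mulr_sumr.
under [in RHS]eq_bigr do rewrite mulr_sumr.
rewrite exchange_big !mulr_sumr; apply: eq_bigr => q _.
by rewrite !mulr_sumr; apply: eq_bigr => n _; rewrite mulrCA.
Qed.

End avg.

(** * Almost invariance of averages under translation *)

Section folner_avg.
Context {R : realType} {r : nat}.
Local Notation V := 'rV[int]_r.
Implicit Types (A : {fset V}) (a : V -> R) (h : V).

Lemma card_translate A h : #|` translate A h| = #|` A|.
Proof. by rewrite card_imfset//=; exact: addIr. Qed.

Lemma sum_translate A h a :
  \sum_(n <- translate A h) a n = \sum_(n <- A) a (n + h).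
Proof. by rewrite big_imfset//= => x y _ _ /addIr. Qed.

Definition invariance_defect A h : R :=
  #|` symdiff (translate A h) A|%:R / #|` A|%:R.

(** The terms over the intersection of [A + h] and [A] cancel, so only the symmetric difference
    contributes. *)
Lemma avg_translate_le A h a (C : R) : (forall n, `|a n| <= C) ->
  `|avg A (fun n => a (n + h)) - avg A a| <= C * invariance_defect A h.
Proof.
move=> aC; rewrite /avg -mulrBr normrM ger0_norm ?invr_ge0//.
rewrite /invariance_defect mulrA [leRHS]mulrC ler_wpM2l ?invr_ge0//.
rewrite -sum_translate; set B := translate A h.
have split_sum (D E : {fset V}) : \sum_(n <- D) a n =
    \sum_(n <- (D `&` E)%fset) a n + \sum_(n <- (D `\` E)%fset) a n.
  rewrite (big_fsetID _ (mem E))/=; congr (_ + _); apply: congr_big => //.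
  - by congr enum_fset; apply/fsetP => x; rewrite !inE.
  - by congr enum_fset; apply/fsetP => x; rewrite !inE andbC.
rewrite (split_sum B A) (split_sum A B) fsetIC opprD addrACA subrr add0r.
have bnd (D : {fset V}) : `|\sum_(n <- D) a n| <= C * #|` D|%:R.
  rewrite (le_trans (ler_norm_sum _ _ _))//.
  rewrite (le_trans (ler_sum _ (fun n _ => aC n)))//.
  by rewrite big_const_seq count_predT iter_addr addr0 mulr_natr.
rewrite (le_trans (ler_normB _ _))// (le_trans (lerD (bnd _) (bnd _)))//.
rewrite -mulrDr -natrD /symdiff cardfsU.
have -> : ((B `\` A) `&` (A `\` B) = fset0)%fset.
  by apply/fsetP => x; rewrite !inE; case: (x \in A); case: (x \in B).
by rewrite cardfs0 subn0.
Qed.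

End folner_avg.

(** * Ultralimits and systems *)

Section bounded_means.
Context {R : realType}.

Definition bounded_fn (K : Type) (f : K -> R) := exists C, forall k, `|f k| <= C.

Lemma bounded_fn_cst K (c : R) : bounded_fn (fun _ : K => c).
Proof. by exists `|c|. Qed.

Lemma bounded_fnD K (f g : K -> R) :
  bounded_fn f -> bounded_fn g -> bounded_fn (fun k => f k + g k).
Proof.
move=> [C fC] [D gD]; exists (C + D) => k.
by rewrite (le_trans (ler_normD _ _))// lerD.
Qed.

Lemma bounded_fnM K (f g : K -> R) :
  bounded_fn f -> bounded_fn g -> bounded_fn (fun k => f k * g k).
Proof.
by move=> [C fC] [D gD]; exists (C * D) => k; rewrite normrM ler_pM.
Qed.

Lemma bounded_fnZ K c (f : K -> R) :
  bounded_fn f -> bounded_fn (fun k => c * f k).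
Proof. by move=> fb; apply: bounded_fnM => //; exact: bounded_fn_cst. Qed.

Lemma bounded_fnX2 K (f : K -> R) :
  bounded_fn f -> bounded_fn (fun k => f k ^+ 2).
Proof. by move=> fb; exact: bounded_fnM. Qed.

(** Common interface for the two ways of averaging over a parameter: the ultralimit over [nat], and
    the ultralimit of finite averages over [nat * V]. *)
Record bounded_mean (K : Type) := BoundedMean {
  bmean :> (K -> R) -> R;
  bmeanD : forall f g, bounded_fn f -> bounded_fn g ->
    bmean (fun k => f k + g k) = bmean f + bmean g;
  bmeanZ : forall c f, bounded_fn f -> bmean (fun k => c * f k) = c * bmean f;
  bmean_ge0 : forall f, bounded_fn f -> (forall k, 0 <= f k) -> 0 <= bmean f;
  bmean1 : bmean (fun=> 1) = 1 }.

End bounded_means.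

Section ultralimit.
Context {R : realType} (U : set_system nat) {UU : UltraFilter U}.
Implicit Types a b : nat -> R.

Definition ulim a : R := lim (a @ U).

(** By compactness of [[-C, C]] the image filter has a cluster point, and an ultrafilter converges
    to each of its cluster points. *)
Lemma ulim_cvg a : bounded_fn a -> a @ U --> ulim a.
Proof.
move=> [C aC].
have aCU : (a @ U) `[- C, C]%classic.
  apply: (@filterE _ U) => k; rewrite /= in_itv/= -ler_norml; exact: aC.
have [p [_ pa]] := @segment_compact R (- C) C _ _ aCU.
apply/cvg_ex; exists p => B Bp.
have [//|UB] := in_ultra_setVsetC (a @^-1` B) UU.
by have [x [? ?]] := pa _ _ (UB : (a @ U) (~` B)) Bp.
Qed.

Lemma ulimE a (l : R) : a @ U --> l -> ulim a = l.
Proof. by move=> al; apply/cvg_lim. Qed.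

Lemma ulim_cst (c : R) : ulim (fun=> c) = c.
Proof. by apply: ulimE; exact: cvg_cst. Qed.

Lemma ulimD a b : bounded_fn a -> bounded_fn b ->
  ulim (fun k => a k + b k) = ulim a + ulim b.
Proof. by move=> ab bb; apply: ulimE; apply: cvgD; exact: ulim_cvg. Qed.

Lemma ulimZ c a : bounded_fn a -> ulim (fun k => c * a k) = c * ulim a.
Proof. by move=> ab; apply: ulimE; apply: cvgMl_tmp; exact: ulim_cvg. Qed.

Lemma le_ulim a b : bounded_fn a -> bounded_fn b ->
  U [set k | a k <= b k] -> ulim a <= ulim b.
Proof.
by move=> ba bb ab; apply: (ler_cvg_to (ulim_cvg ba) (ulim_cvg bb)).
Qed.

Lemma ulim_gt_near a c : bounded_fn a -> c < ulim a -> U [set k | c < a k].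
Proof.
by move=> ab /(cvgr_gt _ (ulim_cvg ab)).
Qed.

Lemma ulim_ge0 a : bounded_fn a -> (forall k, 0 <= a k) -> 0 <= ulim a.
Proof.
move=> ab a0; rewrite -(ulim_cst 0); apply: le_ulim => //.
  exact: bounded_fn_cst.
exact: filterE.
Qed.

Definition ulim_mean := BoundedMean ulimD ulimZ ulim_ge0 (ulim_cst 1).

End ultralimit.

Section ultralimit_of_averages.
Context {R : realType} (U : set_system nat) {UU : UltraFilter U}.
Context {V : choiceType} (A : nat -> {fset V}) (A0 : forall k, A k != fset0).
Implicit Types a b : nat * V -> R.

(** The ultraproduct of the uniform measures on the finite sets [A k], evaluated on a bounded
    function of [(k, q)]. *)
Definition ulim_avg a := ulim U (fun k => avg (A k) (fun q => a (k, q))).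

Lemma bounded_avg a : bounded_fn a ->
  bounded_fn (fun k => avg (A k) (fun q => a (k, q))).
Proof.
by move=> [C aC]; exists C => k; apply: norm_avg_le_cst => // q; exact: aC.
Qed.

Lemma ulim_avgD a b : bounded_fn a -> bounded_fn b ->
  ulim_avg (fun k => a k + b k) = ulim_avg a + ulim_avg b.
Proof.
move=> ab bb; rewrite /ulim_avg -ulimD; [|exact: bounded_avg|exact: bounded_avg].
by congr ulim; apply/funext => k; rewrite avgD.
Qed.

Lemma ulim_avgZ c a : bounded_fn a ->
  ulim_avg (fun k => c * a k) = c * ulim_avg a.
Proof.
move=> ab; rewrite /ulim_avg -ulimZ; last exact: bounded_avg.
by congr ulim; apply/funext => k; rewrite avgZl.
Qed.

Lemma ulim_avg_ge0 a : bounded_fn a -> (forall k, 0 <= a k) -> 0 <= ulim_avg a.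
Proof.
move=> ab a0; apply: ulim_ge0 => [|k]; first exact: bounded_avg.
exact: avg_ge0.
Qed.

Lemma ulim_avg1 : ulim_avg (fun=> 1) = 1.
Proof.
rewrite -[RHS](ulim_cst (U := U) 1); congr ulim; apply/funext => k.
exact: avg_cst.
Qed.

Definition ulim_avg_mean :=
  BoundedMean ulim_avgD ulim_avgZ ulim_avg_ge0 ulim_avg1.

End ultralimit_of_averages.

Section systems.
Context {R : realType} {V : zmodType}.

(** Actions are indexed by [nat] rather than ['I_d], so that the induction on [d] stays within one
    type of systems. [actC] includes [i = j]. *)
Record system := System {
  points :> Type;
  dom : (points -> R) -> Prop;
  mean : (points -> R) -> R;
  act : nat -> V -> points -> points;
  dom_bounded : forall f, dom f -> bounded_fn f;
  dom_cst : forall c, dom (fun=> c);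
  domD : forall f g, dom f -> dom g -> dom (fun x => f x + g x);
  domM : forall f g, dom f -> dom g -> dom (fun x => f x * g x);
  dom_act : forall i n f, dom f -> dom (fun x => f (act i n x));
  meanD : forall f g, dom f -> dom g ->
    mean (fun x => f x + g x) = mean f + mean g;
  meanZ : forall c f, dom f -> mean (fun x => c * f x) = c * mean f;
  mean_ge0 : forall f, dom f -> (forall x, 0 <= f x) -> 0 <= mean f;
  mean1 : mean (fun=> 1) = 1;
  mean_act : forall i n f, dom f -> mean (fun x => f (act i n x)) = mean f;
  act0 : forall i x, act i 0 x = x;
  actD : forall i m n x, act i (m + n) x = act i m (act i n x);
  actC : forall i j m n x, act i m (act j n x) = act j n (act i m x) }.

Variable S : system.
Implicit Types (f g : S -> R) (c : R) (n : V).

Lemma domZ c f : dom f -> dom (fun x => c * f x).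
Proof. by move=> fd; apply: domM => //; exact: dom_cst. Qed.

Lemma domB f g : dom f -> dom g -> dom (fun x => f x - g x).
Proof.
move=> fd gd; under eq_fun do rewrite -mulN1r.
by apply: domD => //; exact: domZ.
Qed.

Lemma domX2 f : dom f -> dom (fun x => f x ^+ 2).
Proof. by move=> fd; exact: domM. Qed.

Lemma dom_sum (I : Type) (s : seq I) (F : I -> S -> R) :
  (forall i, dom (F i)) -> dom (fun x => \sum_(i <- s) F i x).
Proof.
move=> Fd; elim: s => [|i s IH].
  by under eq_fun do rewrite big_nil; exact: dom_cst.
by under eq_fun do rewrite big_cons; exact: domD.
Qed.

Lemma dom_prod d (F : 'I_d -> S -> R) :
  (forall i, dom (F i)) -> dom (fun x => \prod_(i < d) F i x).
Proof.
move=> Fd; elim: (index_enum _) => [|i s IH].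
  by under eq_fun do rewrite big_nil; exact: dom_cst.
by under eq_fun do rewrite big_cons; exact: domM.
Qed.

Lemma dom_avg (A : {fset V}) (F : V -> S -> R) :
  (forall n, dom (F n)) -> dom (fun x => avg A (fun n => F n x)).
Proof. by move=> Fd; apply: domZ; exact: dom_sum. Qed.

Lemma mean_cst c : mean (fun _ : S => c) = c.
Proof.
have -> : (fun _ : S => c) = (fun _ => c * 1) by apply/funext => x; rewrite mulr1.
by rewrite meanZ ?mean1 ?mulr1//; exact: dom_cst.
Qed.

Lemma meanB f g : dom f -> dom g -> mean (fun x => f x - g x) = mean f - mean g.
Proof.
move=> fd gd; under eq_fun do rewrite -mulN1r.
by rewrite meanD ?meanZ ?mulN1r//; exact: domZ.
Qed.

Lemma le_mean f g : dom f -> dom g -> (forall x, f x <= g x) -> mean f <= mean g.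
Proof.
move=> fd gd fg; rewrite -subr_ge0 -meanB//; apply: mean_ge0 => [|x].
  exact: domB.
by rewrite subr_ge0.
Qed.

Lemma mean_avg (A : {fset V}) (F : V -> S -> R) : (forall n, dom (F n)) ->
  mean (fun x => avg A (fun n => F n x)) = avg A (fun n => mean (F n)).
Proof.
move=> Fd; rewrite meanZ; last exact: dom_sum.
congr (_ * _); elim: (enum_fset A) => [|i s IH].
  by under eq_fun do rewrite big_nil; rewrite big_nil mean_cst.
under eq_fun do rewrite big_cons.
by rewrite big_cons meanD ?IH//; exact: dom_sum.
Qed.

Lemma mean_bounded f c : dom f -> (forall x, `|f x| <= c) -> `|mean f| <= c.
Proof.
move=> fd fc; rewrite ler_norml -[in X in X && _](mean_cst (- c)) -{2}(mean_cst c).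
have fcP x : - c <= f x <= c by rewrite -ler_norml.
apply/andP; split; apply: le_mean => //; try exact: dom_cst.
- by move=> x; case/andP: (fcP x).
- by move=> x; case/andP: (fcP x).
Qed.

(** Being Cauchy, unlike having a limit, makes sense in a system that need not be complete. *)
Definition cauchy_mean (u : nat -> S -> R) := forall e, 0 < e ->
  exists N0, forall N N', (N0 <= N)%N -> (N0 <= N')%N ->
    mean (fun x => (u N x - u N' x) ^+ 2) <= e.

Lemma cauchy_meanD (u v : nat -> S -> R) :
  (forall N, dom (u N)) -> (forall N, dom (v N)) ->
  cauchy_mean u -> cauchy_mean v -> cauchy_mean (fun N x => u N x + v N x).
Proof.
move=> ud vd uc vc e e0.
have e4 : 0 < e / 4 by rewrite divr_gt0.
have [Nu {}uc] := uc _ e4; have [Nv {}vc] := vc _ e4.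
exists (maxn Nu Nv) => N N'; rewrite !geq_max => /andP[uN vN] /andP[uN' vN'].
have du : dom (fun x => (u N x - u N' x) ^+ 2) by apply: domX2; exact: domB.
have dv : dom (fun x => (v N x - v N' x) ^+ 2) by apply: domX2; exact: domB.
have /le_trans -> // : mean (fun x => (u N x + v N x - (u N' x + v N' x)) ^+ 2) <=
    2 * mean (fun x => (u N x - u N' x) ^+ 2) +
    2 * mean (fun x => (v N x - v N' x) ^+ 2).
  rewrite -!meanZ// -meanD; [|exact: domZ|exact: domZ]; apply: le_mean => [||x].
  - by apply: domX2; apply: domB; exact: domD.
  - by apply: domD; exact: domZ.
  - set a := u N x; set b := u N' x; set c := v N x; set d := v N' x.
    have := sqr_ge0 ((a - b) - (c - d)); nra.
have := uc _ _ uN uN'; have := vc _ _ vN vN'; lra.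
Qed.

Lemma cauchy_meanZ c (u : nat -> S -> R) : (forall N, dom (u N)) ->
  cauchy_mean u -> cauchy_mean (fun N x => c * u N x).
Proof.
move=> ud uc e e0; have c1 : 0 < 1 + c ^+ 2 by rewrite ltr_pwDl// sqr_ge0.
have [N0 {}uc] := uc _ (divr_gt0 e0 c1); exists N0 => N N' NN NN'.
under eq_fun do rewrite -mulrBr exprMn.
rewrite meanZ; last by apply: domX2; exact: domB.
have := uc _ _ NN NN'; rewrite ler_pdivlMr// mulrDr mulr1 => h.
have : 0 <= mean (fun x => (u N x - u N' x) ^+ 2).
  by apply: mean_ge0 => [|x]; [apply: domX2; exact: domB|exact: sqr_ge0].
nra.
Qed.

Lemma cauchy_mean_sum (I : Type) (s : seq I) (c : I -> R)
    (u : I -> nat -> S -> R) : (forall i N, dom (u i N)) ->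
  (forall i, cauchy_mean (u i)) ->
  cauchy_mean (fun N x => \sum_(i <- s) c i * u i N x).
Proof.
move=> ud uc; elim: s => [|i s IH].
  move=> e e0; exists 0%N => N N' _ _.
  by under eq_fun do rewrite !big_nil subrr expr0n; rewrite mean_cst ltW.
have -> : (fun N x => \sum_(j <- i :: s) c j * u j N x) =
    (fun N x => c i * u i N x + \sum_(j <- s) c j * u j N x).
  by apply/funext => N; apply/funext => x; rewrite big_cons.
apply: cauchy_meanD => //; last exact: cauchy_meanZ.
- by move=> N; exact: domZ.
- by move=> N; apply: dom_sum => j; exact: domZ.
Qed.

(** * Products of a system with a parameter space on which the actions are trivial *)

Section parametrized_system.
Context {K : Type} (M : @bounded_mean R K).

(** The bound is uniform in the parameter because [M] is linear only on bounded functions. With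
    [K = nat] and the ultralimit as [M] this is the ultrapower, without passing to a quotient. *)
Definition pdom (F : S * K -> R) :=
  bounded_fn F /\ forall k, dom (fun x => F (x, k)).
Definition pmean (F : S * K -> R) := M (fun k => mean (fun x => F (x, k))).
Definition pact i n (z : S * K) := (act i n z.1, z.2).

Lemma pdom_slice (F : S * K -> R) :
  pdom F -> bounded_fn (fun k => mean (fun x => F (x, k))).
Proof. by move=> [[C FC] Fd]; exists C => k; exact: mean_bounded. Qed.

Local Obligation Tactic := idtac.

Program Definition param_system : system :=
  @System (S * K)%type pdom pmean pact _ _ _ _ _ _ _ _ _ _ _ _ _.
Next Obligation. by move=> F []. Qed.
Next Obligation.
by move=> c; split => [|k]; [exact: bounded_fn_cst|exact: dom_cst].
Qed.
Next Obligation.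
by move=> F G [? ?] [? ?]; split => [|k]; [exact: bounded_fnD|exact: domD].
Qed.
Next Obligation.
by move=> F G [? ?] [? ?]; split => [|k]; [exact: bounded_fnM|exact: domM].
Qed.
Next Obligation.
move=> i n F [[C FC] Fd]; split => [|k]; first by exists C.
exact: (dom_act i n (Fd k)).
Qed.
Next Obligation.
move=> F G Fd Gd; rewrite /pmean -bmeanD; [|exact: pdom_slice|exact: pdom_slice].
congr bmean; apply/funext => k.
by rewrite meanD//; [exact: Fd.2|exact: Gd.2].
Qed.
Next Obligation.
move=> c F Fd; rewrite /pmean -bmeanZ; last exact: pdom_slice.
by congr bmean; apply/funext => k; rewrite meanZ//; exact: Fd.2.
Qed.
Next Obligation.
move=> F Fd F0; apply: bmean_ge0 => [|k]; first exact: pdom_slice.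
by apply: mean_ge0 => //; exact: Fd.2.
Qed.
Next Obligation.
by rewrite /pmean -[RHS](bmean1 M); congr bmean; apply/funext => k; exact: mean1.
Qed.
Next Obligation.
move=> i n F Fd; congr bmean; apply/funext => k.
exact: (mean_act i n (Fd.2 k)).
Qed.
Next Obligation. by move=> i [x k]; rewrite /pact/= act0. Qed.
Next Obligation. by move=> i m n [x k]; rewrite /pact/= actD. Qed.
Next Obligation. by move=> i j m n [x k]; rewrite /pact/= actC. Qed.

End parametrized_system.

End systems.

(** * The averages and their duals *)

Lemma norm_prod_le (R : realType) d (c : R) (a : 'I_d -> R) :
  (forall i, `|a i| <= c) -> `|\prod_(i < d) a i| <= c ^+ d.
Proof.
move=> ac; rewrite normr_prod -[X in c ^+ X]card_ord -prodr_const.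
by apply: ler_prod => i _; rewrite normr_ge0 ac.
Qed.

Section nonconventional_averages.
Context {R : realType} {r : nat}.
Local Notation V := 'rV[int]_r.
Variable S : @system R V.
Implicit Types (f : nat -> S -> R) (u v h : S -> R) (A : {fset V}) (c C : R).

Definition navg d f A x := avg A (fun n => \prod_(i < d) f i (act i n x)).

(** The last function is split off as [u], in which the average is linear. *)
Definition pavg d f u A x :=
  avg A (fun n => (\prod_(i < d) f i (act i n x)) * u (act d n x)).

(** The adjoint of [u |-> pavg d f u A], applied to [h]; see [mean_pavg_dual]. *)
Definition dual d f h A x := avg A (fun m =>
  h (act d (- m) x) * \prod_(i < d) f i (act i m (act d (- m) x))).

Lemma navgS d f A x : navg d.+1 f A x = pavg d f (f d) A x.
Proof. by apply: eq_avg => n; rewrite big_ord_recr. Qed.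

Lemma dom_navg d f A : (forall i, dom (f i)) -> dom (navg d f A).
Proof.
move=> fd; apply: dom_avg => n; apply: dom_prod => i.
exact: (dom_act i n (fd i)).
Qed.

Lemma dom_pavg d f u A : (forall i, dom (f i)) -> dom u -> dom (pavg d f u A).
Proof.
move=> fd ud; apply: dom_avg => n; apply: domM; last exact: (dom_act d n ud).
by apply: dom_prod => i; exact: (dom_act i n (fd i)).
Qed.

Lemma dom_dual d f h A : (forall i, dom (f i)) -> dom h -> dom (dual d f h A).
Proof.
move=> fd hd; apply: dom_avg => n; apply: domM; first exact: (dom_act d (- n) hd).
apply: dom_prod => i.
exact: (dom_act d (- n) (dom_act i n (fd i))).
Qed.

Lemma pavgD d f u v A x :
  pavg d f (fun y => u y + v y) A x = pavg d f u A x + pavg d f v A x.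
Proof. by rewrite -avgD; apply: eq_avg => n; rewrite mulrDr. Qed.

Lemma pavgZ d f c u A x :
  pavg d f (fun y => c * u y) A x = c * pavg d f u A x.
Proof. by rewrite -avgZl; apply: eq_avg => n; rewrite mulrCA. Qed.

(** Cauchy-Schwarz inside the average, then invariance of the mean. The reindexing [s] is the
    identity for [pavg] and the opposite for [dual]. *)
Lemma mean_sqr_avg_le A (w : V -> S -> R) j (s : V -> V) v c : A != fset0 ->
  0 <= c -> (forall n, dom (w n)) -> dom v ->
  (forall n x, `|w n x| <= c * `|v (act j (s n) x)|) ->
  mean (fun x => (avg A (fun n => w n x)) ^+ 2) <=
  c ^+ 2 * mean (fun x => v x ^+ 2).
Proof.
move=> A0 c0 wd vd wv.
have v2d : dom (fun x => v x ^+ 2) by exact: domX2.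
have bd n : dom (fun x => c ^+ 2 * v (act j (s n) x) ^+ 2).
  by apply: domZ; exact: (dom_act j (s n) v2d).
have : mean (fun x => (avg A (fun n => w n x)) ^+ 2) <=
    mean (fun x => avg A (fun n => c ^+ 2 * v (act j (s n) x) ^+ 2)).
  apply: le_mean => [||x].
  - by apply: domX2; exact: dom_avg.
  - exact: (dom_avg A bd).
  - rewrite (le_trans (sqr_avg_le _ _))// le_avg// => n.
    by rewrite -exprMn -real_normK ?num_real// -(real_normK (num_real (c * _)))
      lerXn2r ?nnegrE// normrM (ger0_norm c0).
move=> /le_trans; apply; rewrite (mean_avg A bd).
rewrite -[leRHS](avg_cst _ A0) le_avg// => n.
by rewrite meanZ ?(mean_act j (s n) v2d)//; exact: (dom_act j (s n) v2d).
Qed.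

Lemma mean_sqr_pavg_le d f u A C : A != fset0 -> 0 <= C ->
  (forall i, dom (f i)) -> dom u -> (forall i x, (i < d)%N -> `|f i x| <= C) ->
  mean (fun x => pavg d f u A x ^+ 2) <= (C ^+ d) ^+ 2 * mean (fun x => u x ^+ 2).
Proof.
move=> A0 C0 fd ud fC.
apply: (@mean_sqr_avg_le _ _ d id) => //.
- by rewrite exprn_ge0.
- move=> n; apply: domM; last exact: (dom_act d n ud).
  by apply: dom_prod => i; exact: (dom_act i n (fd i)).
- by move=> n x; rewrite normrM ler_wpM2r// norm_prod_le// => i; exact: fC.
Qed.

Lemma mean_sqr_dual_le d f h A C : A != fset0 -> 0 <= C ->
  (forall i, dom (f i)) -> dom h -> (forall i x, (i < d)%N -> `|f i x| <= C) ->
  mean (fun x => dual d f h A x ^+ 2) <= (C ^+ d) ^+ 2 * mean (fun x => h x ^+ 2).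
Proof.
move=> A0 C0 fd hd fC; apply: (@mean_sqr_avg_le _ _ d (@GRing.opp V)) => //.
- by rewrite exprn_ge0.
- move=> n; apply: domM; first exact: (dom_act d (- n) hd).
  apply: dom_prod => i; exact: (dom_act d (- n) (dom_act i n (fd i))).
- move=> n x; rewrite normrM mulrC ler_wpM2r// norm_prod_le// => i; exact: fC.
Qed.

Lemma norm_pavg_le d f u A C Cu x : A != fset0 ->
  (forall i x, (i < d)%N -> `|f i x| <= C) -> (forall x, `|u x| <= Cu) ->
  `|pavg d f u A x| <= C ^+ d * Cu.
Proof.
move=> A0 fC uC; apply: norm_avg_le_cst => // n.
by rewrite normrM ler_pM// norm_prod_le// => i; exact: fC.
Qed.

Lemma norm_dual_le d f h A C Ch x : A != fset0 ->
  (forall i x, (i < d)%N -> `|f i x| <= C) -> (forall x, `|h x| <= Ch) ->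
  `|dual d f h A x| <= C ^+ d * Ch.
Proof.
move=> A0 fC hC; apply: norm_avg_le_cst => // n.
by rewrite normrM mulrC ler_pM// norm_prod_le// => i; exact: fC.
Qed.

(** Composing the [n]-th summand with [act d (- n)] preserves its mean and frees [u] from the
    action. *)
Lemma mean_pavg_dual d f u h A : (forall i, dom (f i)) -> dom u -> dom h ->
  mean (fun x => h x * pavg d f u A x) = mean (fun x => dual d f h A x * u x).
Proof.
move=> fd ud hd.
pose p n x := h x * ((\prod_(i < d) f i (act i n x)) * u (act d n x)).
pose q n x := h (act d (- n) x) *
  (\prod_(i < d) f i (act i n (act d (- n) x))) * u x.
have pd n : dom (p n).
  apply: domM => //; apply: domM; last exact: (dom_act d n ud).
  by apply: dom_prod => i; exact: (dom_act i n (fd i)).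
have qp n : q n = (fun x => p n (act d (- n) x)).
  by apply/funext => x; rewrite /p -actD subrr act0 mulrA.
have qd n : dom (q n) by rewrite qp; exact: (dom_act d (- n) (pd n)).
transitivity (avg A (fun n => mean (p n))).
  rewrite -mean_avg//; congr mean; apply/funext => x.
  by rewrite -avgZl.
transitivity (avg A (fun n => mean (q n))).
  by apply: eq_avg => n; rewrite qp (mean_act d (- n) (pd n)).
rewrite -mean_avg//; congr mean; apply/funext => x.
by rewrite [RHS]mulrC -avgZl; apply: eq_avg => n; rewrite [RHS]mulrC.
Qed.

(* Shifting the averaging index m to m + n turns the T_d^n-translate of a dual
   function into an average of functions that see n only through the first d
   actions. *)
Lemma dual_shift d f h A C Ch n x : 0 <= C ->
  (forall i x, (i < d)%N -> `|f i x| <= C) -> (forall x, `|h x| <= Ch) ->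
  `|(\prod_(i < d) f i (act i n x)) * dual d f h A (act d n x) -
    avg A (fun q => h (act d (- q) x) * \prod_(i < d)
      (f i (act i n x) * f i (act i q (act d (- q) (act i n x)))))| <=
  C ^+ d * Ch * C ^+ d * invariance_defect A (- n).
Proof.
move=> C0 fC hC.
pose phi q := (\prod_(i < d) f i (act i n x)) * h (act d (- q) x) *
  \prod_(i < d) f i (act i q (act d (- q) (act i n x))).
have phiC q : `|phi q| <= C ^+ d * Ch * C ^+ d.
  rewrite /phi !normrM; apply: ler_pM => //; first apply: ler_pM => //.
  - by apply: norm_prod_le => i; exact: fC.
  - by apply: norm_prod_le => i; exact: fC.
have := avg_translate_le A (- n) phiC; congr (`|_ - _| <= _).
- rewrite -avgZl; apply: eq_avg => m; rewrite /phi mulrA.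
  congr (_ * h _ * _); first by rewrite -actD opprB addrC.
  apply: eq_bigr => i _; congr f.
  by rewrite (actC d i) -[in LHS]actD subrK opprB -[in RHS]actD [- m + n]addrC.
- by apply: eq_avg => q; rewrite /phi big_split/=; ring.
Qed.

End nonconventional_averages.

(** * The induction on the number of actions *)

(** Each of the infinitely many bad [N] has [a N k > eta] for [U]-almost all [k]; a largest such [N]
    is chosen for each [k]. *)
Lemma ulim_diagonal (R : realType) (U : set_system nat) {UU : UltraFilter U}
    (a : nat -> nat -> R) (eta : R) : \oo `<=` U ->
  (forall N, bounded_fn (a N)) ->
  ~ (exists N0, forall N, (N0 <= N)%N -> ulim U (a N) <= eta) ->
  exists s : nat -> nat, s @ U --> \oo /\ U [set k | eta < a (s k) k].
Proof.
move=> Uoo ba not_le.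
have freq M : exists2 N, (M <= N)%N & eta < ulim U (a N).
  apply: contrapT => noN; apply: not_le; exists M => N MN.
  by rewrite leNgt; apply/negP => lt; apply: noN; exists N.
(* The largest [N <= k] with [a N k > eta], and 0 if there is none. Every bad [N] is a lower bound
   for [s k] on a set in [U], hence [s] tends to infinity. *)
pose s k := (\max_(N < k.+1 | (eta < a N k)%R) N)%N.
have sP N : eta < ulim U (a N) ->
    U [set k | (N <= s k)%N /\ eta < a (s k) k].
  move=> /(ulim_gt_near (ba N)) UN; have /Uoo Uge := nbhs_infty_ge N.
  apply: filterS (filterI UN Uge) => k [/= lt Nk].
  have Nk1 : (N < k.+1)%N by rewrite ltnS.
  split; first exact: (@leq_bigmax_cond _ (fun i : 'I_k.+1 => eta < a i k)
    (@nat_of_ord _) (Ordinal Nk1)).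
  rewrite /s.
  have [|i Pi ->] := @eq_bigmax_cond _ [pred i : 'I_k.+1 | eta < a i k]
    (@nat_of_ord _); last exact: Pi.
  by apply/card_gt0P; exists (Ordinal Nk1).
exists s; split.
  move=> B [M _ MB]; have [N MN /sP] := freq M.
  by apply: (@filterS _ U) => k [/= Nk _]; apply: MB => /=; exact: leq_trans Nk.
have [N _ /sP] := freq 0%N.
by apply: (@filterS _ U) => k [].
Qed.

(** Replaces orthogonal projection where no minimizer need exist: perturbing an almost minimizer [g]
    along [s] can lower the squared distance by at most [delta]. *)
Lemma almost_orthogonal (R : realType) (V : zmodType) (Y : @system R V)
    (W : (Y -> R) -> Prop) (x : Y -> R) (delta : R) :
  (forall u, W u -> dom u) -> W (fun=> 0) ->
  (forall u v, W u -> W v -> W (fun y => u y + v y)) ->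
  (forall c u, W u -> W (fun y => c * u y)) -> dom x -> 0 < delta ->
  exists g, [/\ W g, mean (fun y => (x y - g y) ^+ 2) <=
      mean (fun y => x y ^+ 2) + delta &
    forall s C, W s -> 0 < C -> mean (fun y => s y ^+ 2) <= C ->
      mean (fun y => s y * (x y - g y)) ^+ 2 <= delta * C].
Proof.
move=> Wd W0 WD WZ xd d0.
pose E := [set mean (fun y => (x y - g y) ^+ 2) | g in W].
have infE : has_inf E.
  split; first by exists (mean (fun y => (x y - 0) ^+ 2)); exists (fun=> 0).
  exists 0 => _ [g Wg <-]; apply: mean_ge0 => [|y]; last exact: sqr_ge0.
  by apply: domX2; apply: domB => //; exact: Wd.
have [_ [g Wg <-] gE] := inf_adherent d0 infE.
have gd := Wd _ Wg.
have vd : dom (fun y => x y - g y) by exact: domB.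
exists g; split => //.
  rewrite (le_trans (ltW gE))// lerD2r; apply: ge_inf; first exact: infE.2.
  by exists (fun=> 0) => //; congr mean; apply/funext => y; rewrite subr0.
move=> s C Ws C0 sC; have sd := Wd _ Ws.
set m := mean (fun y => s y * (x y - g y)).
(* This [t] maximizes the gain [2 * t * m - t ^+ 2 * C], whose value is then [m ^+ 2 / C]. *)
set t := m / C.
have WE : inf E <= mean (fun y => (x y - (g y + t * s y)) ^+ 2).
  apply: ge_inf; first exact: infE.2.
  by exists (fun y => g y + t * s y) => //; apply: WD => //; exact: WZ.
have expand : mean (fun y => (x y - (g y + t * s y)) ^+ 2) =
    mean (fun y => (x y - g y) ^+ 2) - 2 * t * m +
    t ^+ 2 * mean (fun y => s y ^+ 2).
  have sv : dom (fun y => s y * (x y - g y)) by exact: domM.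
  have s2 : dom (fun y => s y ^+ 2) by exact: domX2.
  have v2 : dom (fun y => (x y - g y) ^+ 2) by exact: domX2.
  rewrite -!meanZ// -meanB//; last exact: domZ.
  rewrite -meanD; [|by apply: domB => //; exact: domZ|exact: domZ].
  by congr mean; apply/funext => y; ring.
have h1 : 2 * t * m - t ^+ 2 * C <= delta.
  have : t ^+ 2 * mean (fun y => s y ^+ 2) <= t ^+ 2 * C.
    by rewrite ler_wpM2l// sqr_ge0.
  move: WE; rewrite expand; move: gE; lra.
have : 2 * t * m - t ^+ 2 * C = m ^+ 2 / C by rewrite /t; field; exact: lt0r_neq0.
by move=> h2; move: h1; rewrite h2 ler_pdivrMr.
Qed.

Section induction_step.
Context {R : realType} {r : nat}.
Local Notation V := 'rV[int]_r.
Variables (F : nat -> {fset V}) (F_folner : folner R F).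

(** The quantification over all systems is essential: the induction hypothesis is applied to an
    auxiliary system, not to the given one. *)
Definition averages_cauchy d := forall (S : @system R V) (f : nat -> S -> R),
  (forall i, dom (f i)) -> cauchy_mean (fun N => navg d f (F N)).

Lemma cvg_invariance_defect (U : set_system nat) {UU : UltraFilter U}
    (s : nat -> nat) (h : V) : s @ U --> \oo ->
  invariance_defect (F (s k)) h @[k --> U] --> (0 : R).
Proof.
move=> s_oo; have := F_folner.2 h.
exact: (@cvg_comp _ _ _ s (fun N => invariance_defect (F N) h) _ _ _ s_oo).
Qed.

(** * Averages of dual functions in the ultrapower *)

Section dual_functions.
Variables (U : set_system nat) (UU : UltraFilter U).
Variables (s : nat -> nat) (s_oo : s @ U --> \oo).
Variables (S : @system R V) (d : nat) (f : nat -> S -> R) (C : R).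
Hypotheses (fd : forall i, dom (f i)) (C0 : 0 <= C).
Hypothesis fC : forall i x, (i < d)%N -> `|f i x| <= C.

Local Notation Y := (param_system S (@ulim_mean R U UU)).
Local Notation A k := (F (s k)).

Definition lift_fn (i : nat) : Y -> R := fun z => f i z.1.

Definition dual_family (h : Y -> R) : Y -> R :=
  fun z => dual d f (fun x => h (x, z.2)) (A z.2) z.1.

Lemma dom_lift_fn i : dom (lift_fn i).
Proof.
split => [|k]; last exact: fd.
by have [c fc] := dom_bounded (fd i); exists c => z; exact: fc.
Qed.

Lemma dom_dual_family h : dom h -> dom (dual_family h).
Proof.
move=> [[Ch hC] hd]; split => [|k]; last exact: (dom_dual d (A k) fd (hd k)).
exists (C ^+ d * Ch) => z; apply: norm_dual_le => //; exact: F_folner.1.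
Qed.

(** For fixed [N], [dual_shift] turns the average into an average over [q] of [h] times a [d]-fold
    average, with an error vanishing along [U]. *)
Lemma dual_family_cauchy h : averages_cauchy d -> dom h ->
  cauchy_mean (fun N => pavg d lift_fn (dual_family h) (F N)).
Proof.
move=> IH hd; have [[Ch hC] hkd] := hd.
have A0 k : A k != fset0 by exact: F_folner.1.
(* The summation index q of the dual functions becomes a coordinate of Z, so
   that a single application of IH controls all q at once. *)
pose Z := param_system S (@ulim_avg_mean R U UU V (fun k => A k) A0).
pose g i : Z -> R := fun z =>
  f i z.1 * f i (act i z.2.2 (act d (- z.2.2) z.1)).
have gd i : dom (g i).
  split => [|[k q]].
    have [c fc] := dom_bounded (fd i); exists (c * c) => z.
    by rewrite normrM ler_pM.
  apply: domM; first exact: fd.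
  exact: (dom_act d (- q) (dom_act i q (fd i))).
move=> e e0.
(* The factor lost in [le1] is [2 * Ch ^+ 2]; adding 1 keeps the divisor positive. *)
have Ch2 : 0 < 1 + 2 * Ch ^+ 2 by have := sqr_ge0 Ch; lra.
have [N0 IHN] := IH Z g gd _ (divr_gt0 e0 Ch2).
exists N0 => N N' NN NN'.
pose D := C ^+ d * Ch * C ^+ d.
(* The bound of [dual_shift] averaged over [n] in [F N]. *)
pose err N k : R := avg (F N) (fun n => D * invariance_defect (A k) (- n)).
(* The main term: [h] does not involve [n], so it factors out of the average over [F N], which
   becomes a [navg] on [Z]. *)
pose Rn N (x : S) k := avg (A k) (fun q =>
  h (act d (- q) x, k) * navg d g (F N) (x, (k, q))).
have PR M x k : `|pavg d lift_fn (dual_family h) (F M) (x, k) - Rn M x k| <= err M k.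
  have -> : Rn M x k = avg (F M) (fun n => avg (A k) (fun q =>
      h (act d (- q) x, k) * \prod_(i < d) (f i (act i n x) *
        f i (act i q (act d (- q) (act i n x)))))).
    by rewrite avg_exchange; apply: eq_avg => q; rewrite -avgZl.
  rewrite -avgB (le_trans (norm_avg_le _ _))// le_avg// => n.
  by apply: (dual_shift (h := fun x => h (x, k))) => // y; exact: hC.
pose Delta z := navg d g (F N) z - navg d g (F N') z.
have Deltad : @dom _ _ Z (fun z => Delta z ^+ 2).
  by apply: domX2; apply: domB; exact: dom_navg.
have RR x k : (Rn N x k - Rn N' x k) ^+ 2 <=
    Ch ^+ 2 * avg (A k) (fun q => Delta (x, (k, q)) ^+ 2).
  rewrite -avgB -avgZl (le_trans (sqr_avg_le _ _))// le_avg// => q.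
  rewrite -mulrBr exprMn ler_wpM2r ?sqr_ge0// -(real_normK (num_real (h _))).
  by rewrite lerXn2r ?nnegrE// (le_trans _ (hC (x, k))).
pose B k := 2 * Ch ^+ 2 * avg (A k) (fun q => mean (fun x => Delta (x, (k, q)) ^+ 2)).
pose t k := 2 * (err N k + err N' k) ^+ 2.
pose P z := pavg d lift_fn (dual_family h) (F N) z -
  pavg d lift_fn (dual_family h) (F N') z.
have Pd : @dom _ _ Y (fun z => P z ^+ 2).
  by apply: domX2; apply: domB; (apply: dom_pavg; [exact: dom_lift_fn|
    exact: dom_dual_family]).
have PB k : mean (fun x => P (x, k) ^+ 2) <= B k + t k.
  have Dd q : dom (fun x => Delta (x, (k, q)) ^+ 2) by exact: Deltad.2.
  have Bd : dom (fun x : S =>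
      2 * Ch ^+ 2 * avg (A k) (fun q => Delta (x, (k, q)) ^+ 2)).
    by apply: domZ; exact: dom_avg.
  rewrite /B -mean_avg// -meanZ; last exact: dom_avg.
  rewrite -(mean_cst S (t k)) -meanD//; last exact: dom_cst.
  apply: le_mean; first exact: Pd.2.
    by apply: domD => //; exact: dom_cst.
  move=> x; have := PR N x k; have := PR N' x k; have := RR x k.
  rewrite /P /t; set p := pavg _ _ _ (F N) _; set p' := pavg _ _ _ (F N') _.
  set a := err N k; set a' := err N' k; set b := Rn N x k; set b' := Rn N' x k.
  move=> bb; rewrite !ler_norml => /andP[h1 h2] /andP[h3 h4].
  have : (p - p' - (b - b')) ^+ 2 <= (a + a') ^+ 2.
    rewrite -(real_normK (num_real (p - _ - _))) lerXn2r ?nnegrE//; first lra.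
    by rewrite ler_norml; apply/andP; split; lra.
  (* This square is the slack in [P^2 <= 2 B^2 + 2 (P - B)^2], where [P = p - p'] and
     [B = b - b']. *)
  have := sqr_ge0 (p - p' - 2 * (b - b')).
  nra.
(* For fixed [M] this is a finite combination of invariance defects, each vanishing because [s k]
   tends to infinity along [U]. *)
have err0 M : err M k @[k --> U] --> 0.
  have h0 : (0 : R) = (#|` F M|%:R)^-1 * \sum_(n <- F M) D * 0.
    by rewrite big1 ?mulr0// => n _; rewrite mulr0.
  rewrite /err /avg [X in _ --> X]h0; apply: cvgMl_tmp.
  apply: cvg_big => [|n _]; first exact: add_continuous.
  by apply: cvgMl_tmp; exact: cvg_invariance_defect.
have t0 : t k @[k --> U] --> 0.
  have h0 : (0 : R) = 2 * ((0 + 0) * (0 + 0)) by ring.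
  rewrite /t [X in _ --> X]h0; apply: cvgMl_tmp; under eq_cvg do rewrite expr2.
  by apply: cvgM; apply: cvgD; exact: err0.
have Bb : bounded_fn B.
  by apply: bounded_fnZ; exact: (bounded_avg A0 (pdom_slice Deltad)).
have le1 : mean (fun z => P z ^+ 2) <= 2 * Ch ^+ 2 * mean (fun z => Delta z ^+ 2).
  have -> : 2 * Ch ^+ 2 * mean (fun z => Delta z ^+ 2) = ulim U B + 0.
    by rewrite addr0 ulimZ//; exact: (bounded_avg A0 (pdom_slice Deltad)).
  apply: (ler_cvg_to (ulim_cvg (pdom_slice Pd)) (cvgD (ulim_cvg Bb) t0)).
  exact: filterE.
apply: (le_trans le1); have := IHN _ _ NN NN'; rewrite ler_pdivlMr//.
have : 0 <= mean (fun z => Delta z ^+ 2).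
  by apply: mean_ge0 => // z; exact: sqr_ge0.
rewrite -/Delta; nra.
Qed.

End dual_functions.

End induction_step.

(** * Base case, inductive step and conclusion of the induction *)

Section main_induction.
Context {R : realType} {r : nat}.
Local Notation V := 'rV[int]_r.
Variables (F : nat -> {fset V}) (F_folner : folner R F).

Lemma dom_common_bound (S : @system R V) d (f : nat -> S -> R) :
  (forall i, dom (f i)) ->
  exists2 C, 0 <= C & forall i x, (i < d)%N -> `|f i x| <= C.
Proof.
move=> fd; elim: d => [|d [C C0 fC]]; first by exists 0.
have [D fD] := dom_bounded (fd d); exists (C + `|D|); first by rewrite addr_ge0.
move=> i x; rewrite ltnS leq_eqVlt => /predU1P[->|id].
  by rewrite (le_trans (fD x))// (le_trans (ler_norm _))// lerDr.
by rewrite (le_trans (fC i x id))// lerDl.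
Qed.

Lemma averages_cauchy0 : @averages_cauchy R r F 0.
Proof.
move=> S f fd e e0; exists 0%N => N N' _ _.
rewrite (_ : (fun x => _) = fun=> 0) ?mean_cst ?ltW//; apply/funext => x.
have navg0 M : navg 0 f (F M) x = 1.
  rewrite /navg -[RHS](avg_cst (A := F M) 1); last exact: F_folner.1.
  by apply: eq_avg => n; rewrite big_ord0.
by rewrite !navg0 subrr expr0n.
Qed.

Lemma averages_cauchyS d : @averages_cauchy R r F d -> @averages_cauchy R r F d.+1.
Proof.
move=> IH S f fd e e0.
(* A nonprincipal ultrafilter: it contains every cofinite set. *)
have [U [UU Uoo]] := ultraFilterLemma (@eventually_filter).
have [C C0 fC] := dom_common_bound d fd.
pose Y := param_system S (@ulim_mean R U UU).
pose fY : nat -> Y -> R := @lift_fn R r U UU S f.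
have fYd i : dom (fY i) by exact: dom_lift_fn.
have fYC i z : (i < d)%N -> `|fY i z| <= C by move=> /fC; exact.
pose W (u : Y -> R) := dom u /\ cauchy_mean (fun N => pavg d fY u (F N)).
have dpavg u N : dom u -> dom (pavg d fY u (F N)) by exact: dom_pavg.
have Wd u : W u -> dom u by case.
have WZ c u : W u -> W (fun y => c * u y).
  move=> [ud uc]; split; first exact: domZ.
  have -> : (fun N => pavg d fY (fun y => c * u y) (F N)) =
      (fun N y => c * pavg d fY u (F N) y).
    by apply/funext => N; apply/funext => y; rewrite pavgZ.
  by apply: cauchy_meanZ => // N; exact: dpavg.
have WD u v : W u -> W v -> W (fun y => u y + v y).
  move=> [ud uc] [vd vc]; split; first exact: domD.
  have -> : (fun N => pavg d fY (fun y => u y + v y) (F N)) =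
      (fun N y => pavg d fY u (F N) y + pavg d fY v (F N) y).
    by apply/funext => N; apply/funext => y; rewrite pavgD.
  by apply: cauchy_meanD => // N; exact: dpavg.
have W0 : W (fun=> 0).
  split; first exact: dom_cst.
  move=> e' e'0; exists 0%N => N N' _ _.
  rewrite (_ : (fun x => _) = fun=> 0) ?mean_cst ?ltW//; apply/funext => x.
  have p0 M : pavg d fY (fun=> 0) (F M) x = 0.
    by rewrite /pavg /avg big1 ?mulr0// => n _; rewrite mulr0.
  by rewrite !p0 subrr expr0n.
pose x := fY d; have xd : dom x by exact: fYd.
(* The final estimate is [2 * (e / 4) + 4 * (eta + eta) = e]. *)
pose eta := e / 16; have eta0 : 0 < eta by rewrite /eta; lra.
(* Bounds the mean square of [sigma] below: one factor [(C ^+ d) ^+ 2] comes from [dual], the other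
   from the [pavg] in [h], and the rest bounds the mean of [v ^+ 2]. The last 1 gives positivity. *)
pose C' := (C ^+ d) ^+ 2 * ((C ^+ d) ^+ 2 * (mean (fun y => x y ^+ 2) + 1)) + 1.
have x20 : 0 <= mean (fun y => x y ^+ 2).
  by apply: mean_ge0 => [|y]; [exact: domX2|exact: sqr_ge0].
have C'0 : 0 < C'.
  rewrite ltr_pwDr// mulr_ge0 ?sqr_ge0// mulr_ge0 ?sqr_ge0//; lra.
(* The cap 1 bounds the mean of [v ^+ 2] by that of [x ^+ 2] plus 1; the other term gives
   [delta * C' <= eta ^+ 2 / 2], which contradicts [eta_le]. *)
pose delta := Num.min 1 (eta ^+ 2 / (2 * C')).
have delta0 : 0 < delta.
  by rewrite lt_min ltr01 divr_gt0 ?exprn_gt0 ?mulr_gt0.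
have [g [Wg gx ortho]] := almost_orthogonal Wd W0 WD WZ xd delta0.
pose v y := x y - g y.
have vd : @dom _ _ Y v by apply: domB => //; exact: Wd.
have [N1 small] : exists N0, forall N, (N0 <= N)%N ->
    mean (fun y => pavg d fY v (F N) y ^+ 2) <= eta.
  apply: contrapT => not_small.
  have pv2d N : @dom _ _ Y (fun y => pavg d fY v (F N) y ^+ 2).
    by apply: domX2; exact: dpavg.
  have [s [s_oo Ueta]] :=
    ulim_diagonal Uoo (fun N => pdom_slice (pv2d N)) not_small.
  pose h : Y -> R := fun z => pavg d f (fun y => v (y, z.2)) (F (s z.2)) z.1.
  have hd : dom h.
    have [[Cv vC] vkd] := vd.
    split => [|k]; last exact: (dom_pavg d (F (s k)) fd (vkd k)).
    exists (C ^+ d * Cv) => z; apply: norm_pavg_le => //; exact: F_folner.1.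
  pose sigma := @dual_family R r F U UU s S d f h.
  have sd : dom sigma by exact: (dom_dual_family F_folner s fd fC hd).
  have Ws : W sigma.
    by split => //; exact: (dual_family_cauchy F_folner s_oo fd C0 fC IH hd).
  have sC' : mean (fun y => sigma y ^+ 2) <= C'.
    have : mean (fun y => sigma y ^+ 2) <=
        mean (fun y : Y => (C ^+ d) ^+ 2 * ((C ^+ d) ^+ 2 * v y ^+ 2)).
      apply: le_ulim.
      - exact: (pdom_slice (domX2 sd)).
      - exact: (pdom_slice (domZ _ (domZ _ (domX2 vd)))).
      apply: filterE => k /=; have A0 := F_folner.1 (s k).
      have hkd : dom (fun y => h (y, k)) by exact: hd.2.
      have vkd : dom (fun y => v (y, k)) by exact: vd.2.
      rewrite meanZ; last by apply: domZ; exact: domX2.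
      rewrite meanZ; last exact: domX2.
      rewrite (le_trans (mean_sqr_dual_le A0 C0 fd hkd fC))//.
      rewrite ler_wpM2l ?sqr_ge0//.
      exact: (mean_sqr_pavg_le A0 C0 fd vkd fC).
    rewrite meanZ; last by apply: domZ; exact: domX2.
    rewrite meanZ; last exact: domX2.
    move=> /le_trans; apply; rewrite /C'.
    apply: (@le_trans _ _ ((C ^+ d) ^+ 2 * ((C ^+ d) ^+ 2 *
      (mean (fun y => x y ^+ 2) + 1)))); last by rewrite lerDl.
    rewrite ler_wpM2l ?sqr_ge0// ler_wpM2l ?sqr_ge0// (le_trans gx)//.
    by rewrite lerD2l /delta ge_min lexx.
  have := ortho _ _ Ws C'0 sC'.
  (* On the fibre over [k], duality turns the pairing of [sigma] with [v] into the mean of [h ^+ 2],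
     which exceeds [eta] for [U]-almost all [k]. *)
  have eta_le : eta <= mean (fun y => sigma y * (x y - g y)).
    rewrite -(ulim_cst (U := U) eta); apply: le_ulim.
    - exact: bounded_fn_cst.
    - exact: (pdom_slice (domM sd vd)).
    apply: filterS Ueta => k /= /ltW /le_trans; apply.
    have hkd : dom (fun y => h (y, k)) by exact: hd.2.
    have vkd : dom (fun y => v (y, k)) by exact: vd.2.
    by rewrite -(mean_pavg_dual d (F (s k)) fd vkd hkd).
  have : delta <= eta ^+ 2 / (2 * C') by rewrite ge_min lexx orbT.
  rewrite ler_pdivlMr ?mulr_gt0// => delta_le m_le.
  have : eta ^+ 2 <= mean (fun y => sigma y * (x y - g y)) ^+ 2.
    by rewrite lerXn2r ?nnegrE// ?(le_trans (ltW eta0))// ltW.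
  have : 0 < eta ^+ 2 by rewrite exprn_gt0.
  lra.
have [N2 gN] := Wg.2 _ (divr_gt0 e0 (ltr0Sn R 3)).
(* A function independent of the ultrapower coordinate keeps its mean, so the estimate on [Y]
   descends to [S]. *)
have toY (phi : S -> R) : mean phi = @mean _ _ Y (fun z => phi z.1).
  by rewrite -[LHS](ulim_cst (U := U)).
exists (maxn N1 N2) => N N'; rewrite !geq_max => /andP[N1N N2N] /andP[N1N' N2N'].
rewrite toY; pose G M y := pavg d fY g (F M) y; pose H M y := pavg d fY v (F M) y.
have Gd M : dom (G M) by apply: dpavg; exact: Wd.
have Hd M : dom (H M) by exact: dpavg.
have navgE M (z : Y) : navg d.+1 f (F M) z.1 = G M z + H M z.
  rewrite navgS -pavgD; apply: eq_avg => n.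
  by rewrite /v subrKC.
have : mean (fun z : Y => (navg d.+1 f (F N) z.1 - navg d.+1 f (F N') z.1) ^+ 2) <=
    mean (fun z : Y => 2 * (G N z - G N' z) ^+ 2 + 4 * (H N z ^+ 2 + H N' z ^+ 2)).
  apply: le_mean => [||z].
  - under eq_fun do rewrite !navgE; by apply: domX2; apply: domB; exact: domD.
  - apply: domD; apply: domZ; first by apply: domX2; exact: domB.
    by apply: domD; exact: domX2.
  rewrite !navgE; set a := G N z; set a' := G N' z; set b := H N z; set b' := H N' z.
  have := sqr_ge0 (a - a' - (b - b')); have := sqr_ge0 (b + b'); nra.
rewrite meanD; [|by apply: domZ; apply: domX2; exact: domB|
  by apply: domZ; apply: domD; exact: domX2].
rewrite meanZ; last by apply: domX2; exact: domB.
rewrite meanZ; last by apply: domD; exact: domX2.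
rewrite meanD; [|exact: domX2|exact: domX2].
have := gN _ _ N2N N2N'; have := small _ N1N; have := small _ N1N'.
rewrite /eta -/(G N) -/(G N') -/(H N) -/(H N'); lra.
Qed.

Theorem averages_cauchyP d : @averages_cauchy R r F d.
Proof. by elim: d => [|d]; [exact: averages_cauchy0|exact: averages_cauchyS]. Qed.

End main_induction.

(** * Bounded measurable functions *)

Section bounded_measurable.
Context {R : realType} {disp : measure_display} {X : measurableType disp}.
Variable mu : probability X R.
Implicit Types f g : X -> R.

(** Bounded everywhere, as [dom_bounded] demands; essentially bounded functions are truncated
    later. *)
Definition bounded_measurable f := measurable_fun [set: X] f /\ bounded_fn f.

Lemma bounded_measurable_integrable f :
  bounded_measurable f -> mu.-integrable [set: X] (EFin \o f).
Proof.
move=> [mf [C fC]]; apply: measurable_bounded_integrable => //.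
  by apply: (le_lt_trans (probability_le1 mu measurableT)); rewrite ltry.
exists C; split; first exact: num_real.
by move=> x Cx t _; exact: le_trans (fC t) (ltW Cx).
Qed.

Lemma bounded_measurable_comp (T : X -> X) f : measurable_fun [set: X] T ->
  bounded_measurable f -> bounded_measurable (fun x => f (T x)).
Proof.
move=> mT [mf [C fC]]; split; first exact: (measurableT_comp mf mT).
by exists C.
Qed.

Lemma Rintegral_preserving (T : X -> X) f : measurable_fun [set: X] T ->
  (forall A, measurable A -> mu (T @^-1` A) = mu A) -> bounded_measurable f ->
  (\int[mu]_x f (T x))%R = (\int[mu]_x f x)%R.
Proof.
move=> mT Tmu bf; have bfT := bounded_measurable_comp mT bf.
congr fine; transitivity (\int[pushforward mu T]_x (f x)%:E)%E.
  rewrite (integral_pushforward mT) //.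
  - by apply/measurable_EFinP; exact: bf.1.
  - exact: bounded_measurable_integrable.
by apply: eq_measure_integral => A mA _; exact: Tmu.
Qed.

Section integration_system.
Context {V : zmodType}.
Variable T : nat -> V -> X -> X.
Hypotheses (mT : forall i n, measurable_fun [set: X] (T i n))
  (Tmu : forall i n A, measurable A -> mu (T i n @^-1` A) = mu A)
  (T0 : forall i x, T i 0 x = x)
  (TD : forall i m n x, T i (m + n) x = T i m (T i n x))
  (TC : forall i j m n x, T i m (T j n x) = T j n (T i m x)).

Local Obligation Tactic := idtac.

Program Definition integration_system : @system R V :=
  @System R V X bounded_measurable (fun f => (\int[mu]_x f x)%R) T
    _ _ _ _ _ _ _ _ _ _ T0 TD TC.
Next Obligation. by move=> f []. Qed.
Next Obligation.
by move=> c; split; [exact: measurable_cst|exact: bounded_fn_cst].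
Qed.
Next Obligation.
move=> f g [? ?] [? ?].
by split; [exact: measurable_funD|exact: bounded_fnD].
Qed.
Next Obligation.
move=> f g [? ?] [? ?].
by split; [exact: measurable_funM|exact: bounded_fnM].
Qed.
Next Obligation. by move=> i n f; exact: bounded_measurable_comp. Qed.
Next Obligation.
by move=> f g bf bg; apply: RintegralD => //; exact: bounded_measurable_integrable.
Qed.
Next Obligation.
by move=> c f bf; apply: RintegralZl => //; exact: bounded_measurable_integrable.
Qed.
Next Obligation. by move=> f _ f0; apply: Rintegral_ge0. Qed.
Next Obligation.
rewrite /= Rintegral_cst// mul1r -[RHS]/(fine 1); congr fine.
exact: probability_setT.
Qed.
Next Obligation.
by move=> i n f; apply: Rintegral_preserving; [exact: mT|exact: Tmu].
Qed.

End integration_system.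

Lemma bounded_measurableB f g :
  bounded_measurable f -> bounded_measurable g ->
  bounded_measurable (fun x => f x - g x).
Proof.
move=> [mf [C fC]] [mg [D gD]]; split; first exact: measurable_funB.
by exists (C + D) => x; rewrite (le_trans (ler_normB _ _))// lerD.
Qed.

Lemma bounded_measurableD f g :
  bounded_measurable f -> bounded_measurable g ->
  bounded_measurable (fun x => f x + g x).
Proof.
by move=> [mf bf] [mg bg]; split; [exact: measurable_funD|exact: bounded_fnD].
Qed.

Lemma bounded_measurableZ c f :
  bounded_measurable f -> bounded_measurable (fun x => c * f x).
Proof.
move=> [mf bf]; split; last exact: bounded_fnZ.
by apply: measurable_funM => //; exact: measurable_cst.
Qed.

Lemma bounded_measurableX2 f :
  bounded_measurable f -> bounded_measurable (fun x => f x ^+ 2).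
Proof. by move=> [mf bf]; split; [exact: measurable_funX|exact: bounded_fnX2]. Qed.

(** The L1 norms are at most [2 ^- n], so the sum of the [|w n|] is integrable, hence finite almost
    everywhere, and absolute convergence follows. *)
Lemma bounded_cauchy_subsequence (w : nat -> X -> R) :
  (forall n, bounded_measurable (w n)) ->
  (forall n, (\int[mu]_x (w n x ^+ 2))%R <= (4 ^+ n)^-1) ->
  {ae mu, forall x, cvgn (series (fun n => w n x))}.
Proof.
move=> bw w4.
have mw n : measurable_fun [set: X] (fun x => `|w n x|%:E).
  apply/measurable_EFinP; apply: measurableT_comp => //; exact: (bw n).1.
have w2 n : (\int[mu]_x `|w n x|%:E <= ((2 ^+ n)^-1)%:E)%E.
  have babs : bounded_measurable (fun x => `|w n x|).
    split; first by apply/measurable_EFinP; exact: mw.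
    by have [C wC] := (bw n).2; exists C => x; rewrite normr_id.
  have b2 := bounded_measurableX2 (bw n).
  rewrite -[leLHS]fineK; last first.
    exact: (integrable_fin_num measurableT (bounded_measurable_integrable babs)).
  rewrite lee_fin.
  (* Trivial actions, so that the integral is a [mean] and the lemmas on systems apply to it. *)
  pose S := integration_system (V := int) (T := fun _ _ => id)
    (fun _ _ => @measurable_id _ _ _) (fun _ _ _ _ => erefl) (fun _ _ => erefl)
    (fun _ _ _ _ => erefl) (fun _ _ _ _ _ => erefl).
  (* AM-GM: |w| <= (2^n w^2 + 2^-n) / 2 *)
  have h : @mean _ _ S (fun x => `|w n x|) <=
      @mean _ _ S (fun x => (2 ^+ n / 2) * w n x ^+ 2 + (2 ^+ n)^-1 / 2).
    apply: (@le_mean _ _ S) => //.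
      by apply: (@domD _ _ S); [exact: (@domZ _ _ S)|exact: (@dom_cst _ _ S)].
    move=> x; rewrite -(real_normK (num_real (w n x))).
    have p0 : (0 : R) < 2 ^+ n by rewrite exprn_gt0.
    have := sqr_ge0 (2 ^+ n * `|w n x| - 1).
    set a := `|w n x| => sq.
    have : 0 <= (2 ^+ n)^-1 / 2 * (2 ^+ n * a - 1) ^+ 2.
      by rewrite mulr_ge0// divr_ge0// invr_ge0 ltW.
    set p := 2 ^+ n in p0 sq *.
    have -> : p^-1 / 2 * (p * a - 1) ^+ 2 = p / 2 * a ^+ 2 + p^-1 / 2 - a.
      by field; exact: lt0r_neq0.
    lra.
  apply: (le_trans h).
  rewrite (@meanD _ _ S); [|exact: (@domZ _ _ S)|exact: (@dom_cst _ _ S)].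
  rewrite (@meanZ _ _ S)// (@mean_cst _ _ S).
  pose m := (\int[mu]_x (w n x ^+ 2))%R.
  rewrite (_ : mean _ = m)//.
  have p0 : (0 : R) < 2 ^+ n by rewrite exprn_gt0.
  have := w4 n; rewrite -/m; have -> : (4 : R) = 2 * 2 by ring.
  rewrite exprMn; set p := 2 ^+ n in p0 * => mle.
  have : p / 2 * m <= p / 2 * (p * p)^-1 by rewrite ler_wpM2l// divr_ge0// ltW.
  have -> : p / 2 * (p * p)^-1 = p^-1 / 2 by field; exact: lt0r_neq0.
  lra.
pose f x := (\sum_(0 <= n <oo) `|w n x|%:E)%E.
have mf : measurable_fun [set: X] f.
  by apply: ge0_emeasurable_sum => // k x _ _; rewrite lee_fin.
have f0 x : (0 <= f x)%E by apply: nneseries_ge0 => n _ _; rewrite lee_fin.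
have intf : mu.-integrable [set: X] f.
  apply/integrableP; split => //.
  under eq_integral do rewrite gee0_abs//.
  rewrite integral_nneseries//.
  apply: (@le_lt_trans _ _ (\sum_(0 <= n <oo) ((2 ^+ n)^-1)%:E)%E).
    by apply: lee_nneseries => n *; [exact: integral_ge0|exact: w2].
  (* [2 ^- n] is rewritten as [2 / 2 ^ n.+1], the summand in [epsilon_trick0]. *)
  rewrite (@eq_eseriesr _ _ (fun n => (2 / (2 ^ n.+1)%:R)%:E)).
    by rewrite (le_lt_trans (epsilon_trick0 _ _))// ltry.
  by move=> n _; rewrite natrX exprS invfM mulrA divff// mul1r.
have := integrable_ae measurableT intf.
apply: filterS => x /(_ I) fx.
apply: normed_cvg; apply: nondecreasing_is_cvgn.
  by apply: nondecreasing_series => n _ _ /=.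
exists (fine (f x)) => _ [n _ <-].
rewrite -lee_fin fineK// /series/= -sumEFin.
by apply: nneseries_lim_ge => k _ _; rewrite lee_fin.
Qed.

(** The Riesz-Fischer argument: a rapidly Cauchy subsequence converges almost everywhere, and
    dominated convergence identifies its limit as the L2 limit of the whole sequence. *)
Lemma bounded_cauchy_limit (u : nat -> X -> R) (C : R) :
  (forall N, measurable_fun [set: X] (u N)) -> (forall N x, `|u N x| <= C) ->
  (forall e, 0 < e -> exists N0, forall N N', (N0 <= N)%N -> (N0 <= N')%N ->
    (\int[mu]_x ((u N x - u N' x) ^+ 2))%R <= e) ->
  exists2 g, bounded_measurable g & forall e, 0 < e -> exists N0, forall N,
    (N0 <= N)%N -> (\int[mu]_x ((u N x - g x) ^+ 2))%R <= e.
Proof.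
move=> um uC uc.
have bu N : bounded_measurable (u N) by split => //; exists C.
have /choice[s0 s0P] n : exists M, forall N N', (M <= N)%N -> (M <= N')%N ->
    (\int[mu]_x ((u N x - u N' x) ^+ 2))%R <= (4 ^+ n)^-1.
  by apply: uc; rewrite invr_gt0 exprn_gt0.
(* Partial sums make [s] monotone and at least both [s0 n] and [n]. *)
pose s n := (\sum_(i < n.+1) (s0 i).+1)%N.
have sS n : (s n <= s n.+1)%N by rewrite /s [leqRHS]big_ord_recr leq_addr.
have s0s n : (s0 n <= s n)%N.
  by rewrite /s big_ord_recr/= (leq_trans (leqnSn _))// leq_addl.
have ns n : (n <= s n)%N.
  elim: n => // n IH; rewrite /s big_ord_recr/= addnS ltnS.
  by rewrite (leq_trans IH)// leq_addr.
pose w n x := u (s n.+1) x - u (s n) x.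
have ws : {ae mu, forall x, cvgn (series (fun n => w n x))}.
  apply: bounded_cauchy_subsequence => n; first exact: bounded_measurableB.
  by apply: s0P => //; exact: leq_trans (sS n).
(* Clipping keeps g bounded by C also where u (s n) x diverges. *)
pose g x := Num.max (- C) (Num.min C (limn_sup (fun n => u (s n) x))).
have g_lim : {ae mu, forall x, u (s n) x @[n --> \oo] --> g x}.
  apply: filterS ws => x wx.
  have ux : cvgn (fun n => u (s n) x).
    have -> : (fun n => u (s n) x) = (fun n => series (w ^~ x) n + u (s 0%N) x).
      by apply/funext => n; rewrite /series/= telescope_sumr// subrK.
    by apply: is_cvgD => //; exact: is_cvg_cst.
  have lC : - C <= limn (fun n => u (s n) x) <= C.
    apply/andP; split; [apply: limr_ge => //|apply: limr_le => //];
      by apply: nearW => n; have := uC (s n) x; rewrite ler_norml => /andP[].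
  rewrite /g cvg_limn_supE// min_r ?max_r//; by case/andP: lC.
have gC x : `|g x| <= C.
  have C0 : 0 <= C := le_trans (normr_ge0 _) (uC 0%N x).
  by rewrite ler_norml /g le_max lexx/= ge_max ge_min lexx/= (le_trans _ C0)// oppr_le0.
have mg : measurable_fun [set: X] g.
  apply: measurable_maxr; first exact: measurable_cst.
  apply: measurable_minr; first exact: measurable_cst.
  apply: measurable_fun_limn_sup => // x _.
  - exists C => _ [n _ <-]; exact: le_trans (ler_norm _) (uC _ _).
  - by exists (- C) => _ [n _ <-]; have := uC (s n) x; rewrite ler_norml => /andP[].
have bg : bounded_measurable g by split => //; exists C.
exists g => // e e0; have [N0 N0P] := uc e e0; exists N0 => N NN.
have buN M := bounded_measurableX2 (bounded_measurableB (bu N) (bu M)).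
have bgN := bounded_measurableX2 (bounded_measurableB (bu N) bg).
have EFin_int f : bounded_measurable f ->
    (\int[mu]_x (f x)%:E)%E = ((\int[mu]_x f x)%R)%:E.
  move=> bf; rewrite /Rintegral fineK//.
  exact: (integrable_fin_num measurableT (bounded_measurable_integrable bf)).
(* Here [N] is fixed and [n] tends to infinity; the Cauchy bound [e] holds for each [n >= N0] and
   passes to the limit. *)
have [] := @dominated_convergence _ _ _ mu _ measurableT
  (fun n x => ((u N x - u (s n) x) ^+ 2)%:E) (fun x => ((u N x - g x) ^+ 2)%:E)
  (fun=> ((C + C) ^+ 2)%:E).
- by move=> n; apply/measurable_EFinP; exact: (buN (s n)).1.
- by apply/measurable_EFinP; exact: bgN.1.
- apply: filterS g_lim => x ugx _; apply: cvg_EFin; first exact: nearW.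
  apply: (@cvg_comp _ _ _ (fun n => u N x - u (s n) x) (fun y => y ^+ 2) _
    (nbhs (u N x - g x))); last exact: exprn_continuous.
  by apply: cvgB => //; exact: cvg_cst.
- apply: bounded_measurable_integrable.
  by split; [exact: measurable_cst|exact: bounded_fn_cst].
- apply: nearW => x n _; rewrite lee_fin ger0_norm ?sqr_ge0//.
  rewrite -(real_normK (num_real (u N x - _))) lerXn2r ?nnegrE//.
    by rewrite addr_ge0// (le_trans (normr_ge0 _) (uC 0%N x)).
  by rewrite (le_trans (ler_normB _ _))// lerD.
move=> _ _ cvg_int; rewrite -lee_fin -EFin_int//.
have /= /cvg_lim <- // := cvg_int.
apply: lime_le; first by apply/cvg_ex; eexists; exact: cvg_int.
exists N0 => // n /= Nn; rewrite EFin_int// lee_fin; apply: N0P => //.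
exact: leq_trans (ns n).
Qed.

End bounded_measurable.

(** * Real averages along Folner sequences *)

Section folner_sequences.
Context {R : realType} {r : nat}.
Local Notation V := 'rV[int]_r.
Implicit Types (A B : {fset V}) (F G : nat -> {fset V}).

Lemma in_translate A h x : (x \in translate A h) = (x - h \in A).
Proof.
apply/imfsetP/idP => [[y yA ->]|xA]; first by rewrite addrK.
by exists (x - h) => //; rewrite subrK.
Qed.

(** Translations commute, so translating by [a N] merely translates the symmetric difference. This
    absorbs the base points. *)
Lemma folner_translate F (a : nat -> V) :
  folner R F -> folner R (fun N => translate (F N) (a N)).
Proof.
move=> [F0 Fh]; split=> [N|h].
  by rewrite -cardfs_gt0 card_translate cardfs_gt0.
have defect N : #|` symdiff (translate (translate (F N) (a N)) h)
    (translate (F N) (a N))| = #|` symdiff (translate (F N) h) (F N)|.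
  rewrite -(card_translate (symdiff (translate (F N) h) (F N)) (a N)).
  congr (#|` _|); apply/fsetP => x.
  by rewrite !inE !in_translate !inE !in_translate addrAC.
by under eq_cvg do rewrite card_translate defect; exact: Fh.
Qed.

Lemma folner_interlace F G : folner R F -> folner R G ->
  folner R (fun N => if odd N then G N./2 else F N./2).
Proof.
move=> [F0 Fh] [G0 Gh]; split=> [N|h]; first by case: ifP.
apply/cvgrPdist_le => e e0.
have [M1 _ FM] := (cvgrPdist_le _ _).1 (Fh h) e e0.
have [M2 _ GM] := (cvgrPdist_le _ _).1 (Gh h) e e0.
exists (maxn M1 M2).*2 => // N /= MN.
have : (maxn M1 M2 <= N./2)%N by rewrite -(doubleK (maxn _ _)) half_leq.
by rewrite geq_max => /andP[M1N M2N]; case: ifP => _; [exact: GM|exact: FM].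
Qed.

End folner_sequences.

(** The form taken by the real and imaginary parts of a complex average once its product is
    expanded. *)
Definition combination (R : realType) (r d : nat) (X : Type)
    (T : 'I_d -> 'rV[int]_r -> X -> X) (J : Type) (s : seq J) (c : J -> R)
    (f : J -> 'I_d -> X -> R) (A : {fset 'rV[int]_r}) (x : X) : R :=
  \sum_(j <- s) c j * avg A (fun n => \prod_(i < d) f j i (T i n x)).

Section real_averages.
Context {R : realType} {r : nat} {disp : measure_display}.
Context {X : measurableType disp} (mu : probability X R).
Local Notation V := 'rV[int]_r.

(** A fixed sequence [F0] provides [g]; being Cauchy along the interlacing of [F0] and [F] brings
    [a (F N)] close to [a (F0 N)]. *)
Lemma common_limit (a : {fset V} -> X -> R) (C : R) :
  (forall A, measurable_fun [set: X] (a A)) ->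
  (forall A x, A != fset0 -> `|a A x| <= C) ->
  (forall F, folner R F -> forall e, 0 < e -> exists N0, forall N N',
    (N0 <= N)%N -> (N0 <= N')%N ->
    (\int[mu]_x ((a (F N) x - a (F N') x) ^+ 2))%R <= e) ->
  exists2 g, bounded_measurable g & forall F, folner R F ->
    forall e, 0 < e -> exists N0, forall N, (N0 <= N)%N ->
      (\int[mu]_x ((a (F N) x - g x) ^+ 2))%R <= e.
Proof.
move=> ma aC ac.
(* Without any Folner sequence the statement would be vacuous, so that their
   existence need not be proved. *)
have [[F0 fF0]|noF] := pselect (exists F : nat -> {fset V}, folner R F);
  last first.
  exists (fun=> 0); first by split; [exact: measurable_cst|exact: bounded_fn_cst].
  by move=> F fF; case: noF; exists F.
have [g bg ag] := bounded_cauchy_limit (fun N => ma (F0 N))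
  (fun N x => aC _ x (fF0.1 N)) (ac _ fF0).
exists g => // F fF e e0; have e4 : 0 < e / 4 by rewrite divr_gt0.
have [N1 N1P] := ag _ e4.
have [N2 N2P] := ac _ (folner_interlace fF0 fF) _ e4.
exists (maxn N1 N2) => N; rewrite geq_max => /andP[N1N N2N].
have := N1P _ N1N.
have N2d : (N2 <= N.*2)%N by rewrite -addnn (leq_trans N2N) ?leq_addl.
(* At these two indices the interlaced sequence takes the values [F N] and [F0 N]. *)
have := N2P N.*2.+1 N.*2 (leqW N2d) N2d.
rewrite /= odd_double/= uphalf_double doubleK => h1 h2.
have ba A : A != fset0 -> bounded_measurable (a A).
  by move=> A0; split => //; exists C => x; exact: aC.
have bF := ba _ (fF.1 N); have bF0 := ba _ (fF0.1 N).
pose p x := a (F N) x - a (F0 N) x; pose q x := a (F0 N) x - g x.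
have bp := bounded_measurableX2 (bounded_measurableB bF bF0).
have bq := bounded_measurableX2 (bounded_measurableB bF0 bg).
have b2p := bounded_measurableZ 2 bp; have b2q := bounded_measurableZ 2 bq.
apply: (@le_trans _ _ (\int[mu]_x (2 * p x ^+ 2 + 2 * q x ^+ 2))%R).
  apply: le_Rintegral => //.
  - apply: bounded_measurable_integrable.
    exact: (bounded_measurableX2 (bounded_measurableB bF bg)).
  - exact: (bounded_measurable_integrable _ (bounded_measurableD b2p b2q)).
  - move=> x _; rewrite /p /q; set b := a (F N) x; set c := a (F0 N) x.
    have := sqr_ge0 ((b - c) - (c - g x)); nra.
rewrite RintegralD//; [|exact: (bounded_measurable_integrable _ b2p)|
  exact: (bounded_measurable_integrable _ b2q)].
rewrite !RintegralZl//; [|exact: (bounded_measurable_integrable _ bq)|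
  exact: (bounded_measurable_integrable _ bp)].
move: h1 h2; rewrite -/p -/q; lra.
Qed.

Context {d : nat} (T : 'I_d -> V -> X -> X).
Hypotheses (T_pp : forall i, pp_action mu (T i)) (T_comm : commuting_actions T).

(** Padding by trivial actions, which commute with everything, gives the [nat]-indexed family that a
    system requires. *)
Definition extend_act (i : nat) (n : V) (x : X) : X :=
  if (insub i : option 'I_d) is Some j then T j n x else x.

Lemma extend_actE (i : 'I_d) n x : extend_act i n x = T i n x.
Proof. by rewrite /extend_act valK. Qed.

Lemma extend_actC i j m n x :
  extend_act i m (extend_act j n x) = extend_act j n (extend_act i m x).
Proof.
rewrite /extend_act; case: insubP => [k _ _|//]; case: insubP => [l _ _|//].
(* [T_comm] covers distinct indices only; a single action commutes with itself because [V] is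
   abelian. *)
have [->|kl] := eqVneq k l; first by rewrite -!(pp_actionD (T_pp l)) addrC.
exact: (congr1 (@^~ x) (T_comm kl m n)).
Qed.

Definition action_system : @system R V.
Proof.
refine (@integration_system R disp X mu V extend_act _ _ _ _ extend_actC);
  rewrite /extend_act => i; case: insubP => [j _ _|_] //.
- exact: (pp_action_measurable (T_pp j)).
- by move=> n A mA; exact: (pp_action_preserving (T_pp j)).
- exact: (pp_action0 (T_pp j)).
- exact: (pp_actionD (T_pp j)).
Defined.

Section combination.
Context {J : Type} (s : seq J) (c : J -> R) (f : J -> 'I_d -> X -> R).
Hypothesis bf : forall j i, bounded_measurable (f j i).

Definition extend_fn j (i : nat) : action_system -> R :=
  if (insub i : option 'I_d) is Some k then f j k else fun=> 1.

Lemma extend_fn_bounded_measurable j i : bounded_measurable (extend_fn j i).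
Proof.
rewrite /extend_fn; case: insubP => [k _ _|_]; first exact: bf.
by split; [exact: measurable_cst|exact: bounded_fn_cst].
Qed.

Lemma combinationE A : combination T s c f A =
  (fun x : action_system => \sum_(j <- s) c j * navg d (extend_fn j) A x).
Proof.
apply/funext => x; apply: eq_bigr => j _; congr (_ * _); apply: eq_avg => n.
by apply: eq_bigr => i _; rewrite /extend_fn valK -extend_actE.
Qed.

Lemma combination_bounded_measurable A : bounded_measurable (combination T s c f A).
Proof.
rewrite combinationE; apply: (@dom_sum _ _ action_system) => j.
apply: (@domZ _ _ action_system); apply: dom_navg => i.
exact: extend_fn_bounded_measurable.
Qed.

Lemma combination_bounded : exists C, forall A x, A != fset0 ->
  `|combination T s c f A x| <= C.
Proof.
have /choice[C fC] j : exists C, forall i x, `|f j i x| <= C.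
  have [D D0 fD] := dom_common_bound (S := action_system) d
    (extend_fn_bounded_measurable j).
  by exists D => i x; have := fD i x (ltn_ord i); rewrite /extend_fn valK.
exists (\sum_(j <- s) `|c j| * C j ^+ d) => A x A0.
rewrite (le_trans (ler_norm_sum _ _ _))// ler_sum// => j _.
rewrite normrM ler_wpM2l// norm_avg_le_cst// => n.
by apply: norm_prod_le => i; exact: fC.
Qed.

Lemma combination_cauchy F : folner R F -> forall e, 0 < e ->
  exists N0, forall N N', (N0 <= N)%N -> (N0 <= N')%N ->
    (\int[mu]_x
      ((combination T s c f (F N) x - combination T s c f (F N') x) ^+ 2))%R <= e.
Proof.
move=> fF e e0.
have [|j|N0 N0P] := @cauchy_mean_sum _ _ action_system J s c
  (fun j N => navg d (extend_fn j) (F N)) _ _ e e0.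
- by move=> j N; apply: dom_navg => i; exact: extend_fn_bounded_measurable.
- by apply: (averages_cauchyP fF) => i; exact: extend_fn_bounded_measurable.
- by exists N0 => N N' NN NN'; rewrite !combinationE; exact: N0P.
Qed.

Lemma combination_limit : exists2 g, bounded_measurable g &
  forall F, folner R F -> forall e, 0 < e -> exists N0, forall N, (N0 <= N)%N ->
    (\int[mu]_x ((combination T s c f (F N) x - g x) ^+ 2))%R <= e.
Proof.
have [C fC] := combination_bounded.
apply: common_limit fC combination_cauchy => A.
exact: (combination_bounded_measurable A).1.
Qed.

End combination.

End real_averages.

(** * Complex-valued functions *)

Section complex_parts.
Context {R : realType}.
Local Open Scope complex_scope.

(** With a Boolean index, choosing a part in each of [d] factors amounts to an element of
    [{ffun 'I_d -> bool}]. *)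
Definition part (b : bool) (z : R[i]) : R :=
  if b then complex.Im z else complex.Re z.

Definition part_unit (b : bool) : R[i] := if b then 'i else 1.

Lemma partD b z w : part b (z + w) = part b z + part b w.
Proof. by case: b z w => [] [? ?] [? ?]. Qed.

Lemma partN b z : part b (- z) = - part b z.
Proof. by case: b z => [] [? ?]. Qed.

Lemma partB b z w : part b (z - w) = part b z - part b w.
Proof. by rewrite partD partN. Qed.

Lemma part_sum b (I : Type) (s : seq I) (F : I -> R[i]) :
  part b (\sum_(i <- s) F i) = \sum_(i <- s) part b (F i).
Proof.
elim: s => [|i s IH]; first by rewrite !big_nil; case: b.
by rewrite !big_cons partD IH.
Qed.

Lemma partMr b z r : part b (z * r%:C) = part b z * r.
Proof. by case: b z => [] [x y] /=; ring. Qed.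

Lemma part_decomp z : z = \sum_(b : bool) part_unit b * (part b z)%:C.
Proof. by rewrite big_bool/= [LHS]complexE mul1r addrC. Qed.

Lemma sqr_normc z :
  ComplexField.Normc.normc z ^+ 2 = part false z ^+ 2 + part true z ^+ 2.
Proof. by case: z => x y; rewrite sqr_sqrtr// addr_ge0 ?sqr_ge0. Qed.

Lemma normc_ge0 (z : R[i]) : 0 <= ComplexField.Normc.normc z.
Proof. by case: z => x y; exact: sqrtr_ge0. Qed.

Lemma norm_part_le b z : `|part b z| <= ComplexField.Normc.normc z.
Proof.
case: z => x y; rewrite -sqrtr_sqr ler_sqrt ?addr_ge0 ?sqr_ge0//.
by case: b; rewrite ?lerDl ?lerDr sqr_ge0.
Qed.

Context {r d : nat} {X : Type}.
Variables (T : 'I_d -> 'rV[int]_r -> X -> X).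

(** Each factor is split into its two parts and the product is expanded over all choices [phi];
    [part b] is real linear, so it acts only on the constants, products of 1 and ['i]. *)
Lemma part_nonconventional_average b (f : 'I_d -> X -> R[i])
    (A : {fset 'rV[int]_r}) a x :
  part b (nonconventional_average T f A a x) =
  combination T (index_enum {ffun 'I_d -> bool})
    (fun phi => part b (\prod_i part_unit (phi i)))
    (fun phi i y => part (phi i) (f i y)) (translate A a) x.
Proof.
have -> : nonconventional_average T f A a x =
    \sum_(phi : {ffun 'I_d -> bool}) (\prod_i part_unit (phi i)) *
      (avg (translate A a) (fun n => \prod_(i < d) part (phi i) (f i (T i n x))))%:C.
  transitivity ((#|` A|%:R)^-1 * \sum_(n <- translate A a)
      \sum_(phi : {ffun 'I_d -> bool}) \prod_i
        (part_unit (phi i) * (part (phi i) (f i (T i n x)))%:C)).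
    congr (_ * _); apply: eq_bigr => n _.
    rewrite -(bigA_distr_bigA (fun i b => part_unit b * (part b (f i (T i n x)))%:C)).
    by apply: eq_bigr => i _; exact: part_decomp.
  rewrite exchange_big mulr_sumr; apply: eq_bigr => phi _.
  rewrite /avg rmorphM fmorphV rmorph_nat card_translate rmorph_sum/=.
  rewrite mulrCA; congr (_ * _); rewrite mulr_sumr; apply: eq_bigr => n _.
  by rewrite big_split/= rmorph_prod.
by rewrite part_sum; apply: eq_bigr => phi _; rewrite partMr.
Qed.

End complex_parts.

Section complex_functions.
Context {R : realType} {disp : measure_display} {X : measurableType disp}.
Variable mu : probability X R.
Implicit Types h g : X -> R[i].

Definition measurable_parts h :=
  forall b, measurable_fun [set: X] (fun x => part b (h x)).

Definition bounded_parts h :=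
  forall b, bounded_measurable (fun x => part b (h x)).

Lemma Lnorm2_normc h :
  ('N[mu]_2%:E[EFin \o (fun x => ComplexField.Normc.normc (h x))])%E =
  ((\int[mu]_x (part false (h x) ^+ 2 + part true (h x) ^+ 2)%:E) `^ 2^-1)%E.
Proof.
rewrite unlock /Lnorm; congr (_ `^ _)%E; apply: eq_integral => x _ /=.
rewrite ger0_norm ?normc_ge0// -sqr_normc -powR_mulrn ?normc_ge0//.
Qed.

Lemma Lnorm2_bounded_parts h : bounded_parts h ->
  ('N[mu]_2%:E[EFin \o (fun x => ComplexField.Normc.normc (h x))])%E =
  (Num.sqrt ((\int[mu]_x (part false (h x) ^+ 2))%R +
             (\int[mu]_x (part true (h x) ^+ 2))%R))%:E.
Proof.
move=> bh; have b0 := bounded_measurableX2 (bh false).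
have b1 := bounded_measurableX2 (bh true).
rewrite Lnorm2_normc -RintegralD//; try exact: bounded_measurable_integrable.
rewrite /Rintegral -powR12_sqrt -?poweR_EFin ?fineK//.
- exact: (integrable_fin_num measurableT
    (bounded_measurable_integrable _ (bounded_measurableD b0 b1))).
- by apply: Rintegral_ge0 => x _; rewrite addr_ge0 ?sqr_ge0.
Qed.

Lemma cvg_L2C_bounded (u : nat -> X -> R[i]) g :
  (forall N, bounded_parts (u N)) -> bounded_parts g ->
  (forall b e, 0 < e -> exists N0, forall N, (N0 <= N)%N ->
    (\int[mu]_x ((part b (u N x) - part b (g x)) ^+ 2))%R <= e) ->
  cvg_L2C mu u g.
Proof.
move=> bu bg ug.
have bug N : bounded_parts (fun x => u N x - g x).
  move=> b; rewrite (_ : (fun x => _) = fun x => part b (u N x) - part b (g x)).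
    exact: bounded_measurableB (bu N b) (bg b).
  by apply/funext => x; rewrite partB.
rewrite /cvg_L2C; under eq_cvg do rewrite Lnorm2_bounded_parts//.
apply: cvg_EFin; first exact: nearW.
apply/cvgrPdist_le => e e0 /=.
have e2 : 0 < e ^+ 2 / 2 by rewrite divr_gt0// exprn_gt0.
have [N0 N0P] := ug false _ e2; have [N1 N1P] := ug true _ e2.
exists (maxn N0 N1) => // N /=; rewrite geq_max => /andP[N0N N1N].
rewrite sub0r normrN ger0_norm ?sqrtr_ge0// -(ger0_norm (ltW e0)) -sqrtr_sqr.
rewrite ler_sqrt ?sqr_ge0//; have := N0P _ N0N; have := N1P _ N1N.
have E b : (\int[mu]_x (part b (u N x - g x) ^+ 2))%R =
    (\int[mu]_x ((part b (u N x) - part b (g x)) ^+ 2))%R.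
  by congr Rintegral; apply/funext => x; rewrite partB.
by rewrite (E false) (E true); lra.
Qed.

Lemma cvg_L2C_ae (u v : nat -> X -> R[i]) g :
  (forall N, measurable_parts (u N)) -> (forall N, measurable_parts (v N)) ->
  measurable_parts g -> (forall N, {ae mu, forall x, u N x = v N x}) ->
  cvg_L2C mu v g -> cvg_L2C mu u g.
Proof.
move=> um mv mg uv; rewrite /cvg_L2C; apply: cvg_trans.
apply: near_eq_cvg; apply: nearW => N /=; rewrite !Lnorm2_normc.
have mB (w : X -> R[i]) : measurable_parts w -> measurable_fun [set: X]
    (fun x => (part false (w x - g x) ^+ 2 + part true (w x - g x) ^+ 2)%:E).
  move=> mw; have mp b : measurable_fun [set: X] (fun x => part b (w x - g x)).
    rewrite (_ : (fun x => _) = fun x => part b (w x) - part b (g x)).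
      exact: measurable_funB (mw b) (mg b).
    by apply/funext => x; rewrite partB.
  apply/measurable_EFinP; apply: measurable_funD;
    apply: measurable_funX; exact: mp.
congr (_ `^ _)%E; apply: ae_eq_integral => //; try exact: mB.
by apply: filterS (uv N) => x -> _.
Qed.

Lemma LfunC2_bounded_parts g : bounded_parts g -> LfunC mu 2%:E g.
Proof.
move=> bg; split; [exact: (bg false).1|exact: (bg true).1|].
by rewrite /finite_norm Lnorm2_bounded_parts// ltry.
Qed.

Lemma LfunC_oo_bound h : LfunC mu +oo%E h ->
  exists C, {ae mu, forall x, ComplexField.Normc.normc (h x) <= C}.
Proof.
move=> [_ _]; rewrite /finite_norm unlock /Lnorm.
(* The norm at infinity is defined by cases on whether the total mass is positive. *)
have -> : (0 < mu [set: X])%E by rewrite [mu _]probability_setT.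
move=> hoo; have [|C hC] := @ess_supr_bounded _ _ _ mu
  (fun x => `|ComplexField.Normc.normc (h x)|); first exact: hoo.
by exists C; apply: filterS hC => x; exact: le_trans (ler_norm _).
Qed.

Definition clip (C y : R) : R := Num.max (- C) (Num.min C y).

Lemma norm_clip_le C y : 0 <= C -> `|clip C y| <= C.
Proof.
move=> C0; rewrite ler_norml /clip le_max lexx/= ge_max ge_min lexx/= andbT.
by rewrite (le_trans _ C0)// oppr_le0.
Qed.

Lemma clip_id C y : `|y| <= C -> clip C y = y.
Proof. by rewrite ler_norml => /andP[? ?]; rewrite /clip min_r ?max_r. Qed.

(** Each part is clipped at [|C|], which changes nothing almost everywhere since a part is at most
    the modulus. *)
Lemma LfunC_oo_truncate h : LfunC mu +oo%E h ->
  exists2 k, bounded_parts k & {ae mu, forall x, h x = k x}.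
Proof.
move=> hL; have [C hC] := LfunC_oo_bound hL; have [mRe mIm _] := hL.
pose k x := Complex (clip `|C| (complex.Re (h x))) (clip `|C| (complex.Im (h x))).
have mclip (f : X -> R) : measurable_fun [set: X] f ->
    bounded_measurable (fun x => clip `|C| (f x)).
  move=> mf; split; last by exists `|C| => x; exact: norm_clip_le.
  apply: measurable_maxr; first exact: measurable_cst.
  by apply: measurable_minr => //; exact: measurable_cst.
exists k => [[]|]; [exact: mclip|exact: mclip|].
apply: filterS hC => x hC; have hp b : `|part b (h x)| <= `|C|.
  by rewrite (le_trans (norm_part_le _ _))// (le_trans hC)// ler_norm.
rewrite /k (clip_id (hp false)) (clip_id (hp true)); by case: (h x).
Qed.

End complex_functions.

Section almost_everywhere.
Context {R : realType} {disp : measure_display} {X : measurableType disp}.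
Context {mu : probability X R} {r d : nat}.
Variable T : 'I_d -> 'rV[int]_r -> X -> X.
Hypothesis T_pp : forall i, pp_action mu (T i).

Lemma ae_preserving (S : X -> X) (P : X -> Prop) : measurable_fun [set: X] S ->
  (forall A, measurable A -> mu (S @^-1` A) = mu A) ->
  {ae mu, forall x, P x} -> {ae mu, forall x, P (S x)}.
Proof.
move=> mS Smu [A [mA A0 PA]]; exists (S @^-1` A); split.
- by rewrite -[X in measurable X]setTI; exact: mS.
- by rewrite Smu.
- by move=> x /= nP; exact: PA.
Qed.

(** There are countably many pairs [(i, n)], enumerated by [unpickle], and each preimage of a null
    set is null. *)
Lemma ae_forall_translates (P : 'I_d -> X -> Prop) :
  (forall i, {ae mu, forall x, P i x}) ->
  {ae mu, forall x, forall i n, P i (T i n x)}.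
Proof.
move=> aeP.
have : {ae mu, forall x, forall k i n,
    choice.unpickle k = Some (i, n) -> P i (T i n x)}.
  apply: ae_foralln => k.
  case: (choice.unpickle k) => [[i n]|]; last by apply: nearW.
  have := ae_preserving (pp_action_measurable (T_pp i) n)
    (pp_action_preserving (T_pp i) n) (aeP i).
  by apply: filterS => x Px j m [<- <-].
apply: filterS => x Px i n.
exact: (Px (choice.pickle (i, n)) i n (choice.pickleK _)).
Qed.

Lemma combination_measurable (J : Type) (s : seq J) (c : J -> R)
    (f : J -> 'I_d -> X -> R) A :
  (forall j i, measurable_fun [set: X] (f j i)) ->
  measurable_fun [set: X] (combination T s c f A).
Proof.
move=> mf; apply: measurable_sum => j; apply: measurable_funM.
  exact: measurable_cst.
apply: measurable_funM; first exact: measurable_cst.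
apply: measurable_sum => n; apply: measurable_prod => i _.
exact: (measurableT_comp (mf j i) (pp_action_measurable (T_pp i) n)).
Qed.

End almost_everywhere.

(** * Assembly: truncation, limits of the two parts, and base points *)

Theorem theorem1p1 (R : realType) (d r : nat)
    (d_gt0 : (0 < d)%N) (r_gt0 : (0 < r)%N)
    (disp : measure_display) (X : measurableType disp)
    (X_std : standard_borel R X) (mu : probability X R)
    (T : 'I_d -> 'rV[int]_r -> X -> X)
    (T_pp : forall i : 'I_d, pp_action mu (T i))
    (T_comm : commuting_actions T)
    (f : 'I_d -> X -> R[i])
    (f_Linfty : forall i : 'I_d, LfunC mu +oo%E (f i)) :
  exists2 g : X -> R[i], LfunC mu 2%:E g &
    forall (I : nat -> {fset 'rV[int]_r}) (a : nat -> 'rV[int]_r),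
      folner R I ->
      cvg_L2C mu (fun N : nat => nonconventional_average T f (I N) (a N)) g.
Proof.
have /choice[k kP] i : exists k, bounded_parts k /\ {ae mu, forall x, f i x = k x}.
  by have [k bk fk] := LfunC_oo_truncate (f_Linfty i); exists k.
have bk i : bounded_parts (k i) := (kP i).1.
(* The limits of both parts are fixed before [I] and [a] are introduced, which is the claimed
   independence. *)
have /choice[gp gpP] b : exists g, bounded_measurable g /\
    forall F, folner R F -> forall e, 0 < e -> exists N0, forall N, (N0 <= N)%N ->
    (\int[mu]_x ((combination T (index_enum {ffun 'I_d -> bool})
      (fun phi => part b (\prod_i part_unit (phi i)))
      (fun phi i y => part (phi i) (k i y)) (F N) x - g x) ^+ 2))%R <= e.
  have [g bg gP] := combination_limit T_pp T_comm
    (index_enum {ffun 'I_d -> bool}) (fun phi => part b (\prod_i part_unit (phi i)))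
    (fun phi i => bk i (phi i)).
  by exists g.
pose g x := Complex (gp false x) (gp true x).
have bg : bounded_parts g by case; exact: (gpP _).1.
exists g; first exact: LfunC2_bounded_parts.
move=> I a fI; pose v N := nonconventional_average T k (I N) (a N).
have mf i b : measurable_fun [set: X] (fun x => part b (f i x)).
  by case: (f_Linfty i) => mRe mIm _; case: b.
have bv N : bounded_parts (v N).
  move=> b; rewrite (_ : (fun x => _) = combination T (index_enum {ffun 'I_d -> bool})
      (fun phi => part b (\prod_i part_unit (phi i)))
      (fun phi i y => part (phi i) (k i y)) (translate (I N) (a N))).
    by apply: (combination_bounded_measurable T_pp T_comm) => phi i; exact: bk.
  by apply/funext => x; exact: part_nonconventional_average.
apply: (@cvg_L2C_ae _ _ _ _ _ v).
- move=> N b; rewrite (_ : (fun x => _) = combination T (index_enum {ffun 'I_d -> bool})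
      (fun phi => part b (\prod_i part_unit (phi i)))
      (fun phi i y => part (phi i) (f i y)) (translate (I N) (a N))).
    by apply: (combination_measurable T_pp) => phi i; exact: mf.
  by apply/funext => x; exact: part_nonconventional_average.
- by move=> N b; exact: (bv N b).1.
- by move=> b; exact: (bg b).1.
- move=> N; apply: filterS (ae_forall_translates T_pp (fun i => (kP i).2)) => x fk.
  congr (_ * _); apply: eq_bigr => n _; apply: eq_bigr => i _; exact: fk.
apply: cvg_L2C_bounded => // b e e0.
(* The base points enter only through the translated sequence, itself a Folner sequence. *)
have [N0 N0P] := (gpP b).2 _ (folner_translate a fI) _ e0.
exists N0 => N /N0P; apply: le_trans; rewrite le_eqVlt; apply/orP; left; apply/eqP.
congr Rintegral; apply/funext => x.
by rewrite part_nonconventional_average; case: (b).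
Qed.
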